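(* Let $n\ge2$, $\frac{n-1}{2}<s<n-1$, and let $X\subset\partial_\infty\mathbb{H}^n$ be a truly $s$-dimensional set, with identification centered at $o\in\mathbb{H}^n$ and constant $K$ as in condition (iv). Then there is a bounded function $u\in C^\infty(\mathbb{H}^n)$ with $-\Delta u=\frac{(n-1)^2}{4}u$ on $\mathbb{H}^n$ and an open set $\Omega\subset\mathbb{H}^n$ on which $u>0$ (and $u=0$ on $\partial\Omega$) such that $\partial_\infty\Omega=\overline X$. Moreover, for every $p\in\Omega$, $$|u(p)|\le M_0\,(d+1)\,e^{-\left(s-\frac{n-1}{2}\right)d},\qquad d=d(p,o),$$ where $M_0>0$ depends only on $K$, $n$ and $s$.
   Context: $\mathbb{H}^n$ is hyperbolic space, $\Delta$ its Laplace–Beltrami operator, $\partial_\infty\mathbb{H}^n$ its ideal boundary (classes of geodesic rays at bounded distance) with the cone topology, and $\partial_\infty\Omega$ the boundary of $\Omega$ in $\mathbb{H}^n\cup\partial_\infty\mathbb{H}^n$ minus its boundary in $\mathbb{H}^n$. Choosing a point $o$ and a Poincaré ball model $B=\{x\in\mathbb{R}^n:|x|<1\}$ (metric $\frac{4}{(1-|x|^2)^2}\delta_{ij}$) with $o$ at the origin identifies $\partial_\infty\mathbb{H}^n$ with the unit sphere $\partial B$. A set $X\subset\partial_\infty\mathbb{H}^n$ is truly $s$-dimensional if, for some such identification, its image $\Lambda\subset\partial B$ satisfies: (i) Hausdorff dimension $s$; (ii) $H^s(\Lambda)<\infty$; (iii) $\liminf_{r\to0}H^s(\Lambda\cap B_r(p_0))/r^s>0$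 for every $p_0\in\Lambda$; (iv) there is $K>0$ with $H^s(\Lambda\cap B_r(p_0))\le Kr^s$ for all $p_0\in\Lambda$, $r>0$; here $H^s$ is Euclidean Hausdorff measure and $B_r(p_0)$ the Euclidean ball in $\mathbb{R}^n$. *)

(* Defs.v *)
(* classical real numbers. Everything is stated in the
   Poincare ball model B = {x in R^n : |x| < 1} with o at the origin. *)
From Stdlib Require Import Reals Lra List.
Open Scope R_scope.

(* Points of R^n are represented as functions nat -> R vanishing at
   indices >= n (see inRn). *)
Definition pt := nat -> R.

Fixpoint rsum (n : nat) (f : nat -> R) : R :=
  match n with O => 0 | S m => rsum m f + f m end.

Definition vnorm (n : nat) (x : pt) : R := sqrt (rsum n (fun i => x i ^ 2)).
Definition vsub (x y : pt) : pt := fun i => x i - y i.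
Definition dist (n : nat) (x y : pt) : R := vnorm n (vsub x y).
Definition origin : pt := fun _ => 0.

Definition inRn (n : nat) (x : pt) : Prop := forall i, (n <= i)%nat -> x i = 0.
Definition unit_ball (n : nat) (x : pt) : Prop := inRn n x /\ vnorm n x < 1.
Definition unit_sphere (n : nat) (x : pt) : Prop := inRn n x /\ vnorm n x = 1.
Definition eball (n : nat) (p : pt) (r : R) (x : pt) : Prop :=
  inRn n x /\ dist n x p < r.

Definition shift (x : pt) (i : nat) (t : R) : pt :=
  fun j => if Nat.eqb j i then x j + t else x j.

Definition continuous_on (n : nat) (U : pt -> Prop) (f : pt -> R) : Prop :=
  forall x, U x -> forall eps, 0 < eps -> exists delta, 0 < delta /\
    forall y, U y -> dist n y x < delta -> Rabs (f y - f x) < eps.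

(* D a is the iterated partial derivative of u along the multi-index a:
   D (i :: a) = d/dx_i (D a); all are continuous on U.
   The existence of such D on an open U means u is C^infinity on U. *)
Definition is_partials (n : nat) (U : pt -> Prop) (u : pt -> R)
  (D : list nat -> pt -> R) : Prop :=
  (forall x, U x -> D nil x = u x) /\
  (forall a i x, U x -> (i < n)%nat ->
     derivable_pt_lim (fun t => D a (shift x i t)) 0 (D (i :: a) x)) /\
  (forall a, continuous_on n U (D a)).

(* Laplace-Beltrami operator of the metric 4/(1-|x|^2)^2 delta_ij on B,
   written in coordinates:  Delta u = ((1-|x|^2)^2/4) sum_i d_i d_i u
                              + (n-2) ((1-|x|^2)/2) sum_i x_i d_i u. *)
Definition hyp_laplacian (n : nat) (D : list nat -> pt -> R) (x : pt) : R :=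
  (1 - vnorm n x ^ 2) ^ 2 / 4 * rsum n (fun i => D (i :: i :: nil) x)
  + (INR n - 2) * ((1 - vnorm n x ^ 2) / 2) * rsum n (fun i => x i * D (i :: nil) x).

Definition arcosh (z : R) : R := ln (z + sqrt (z ^ 2 - 1)).

Definition hyp_dist (n : nat) (x y : pt) : R :=
  arcosh (1 + 2 * dist n x y ^ 2 / ((1 - vnorm n x ^ 2) * (1 - vnorm n y ^ 2))).

Definition Hcover_bound (n : nat) (s delta : R) (A : pt -> Prop) (c : R) : Prop :=
  exists (U : nat -> pt -> Prop) (r : nat -> R),
    (forall x, A x -> exists i, U i x) /\
    (forall i, 0 < r i <= delta) /\
    (forall i x y, U i x -> U i y -> dist n x y <= r i) /\
    exists l, infinite_sum (fun i => Rpower (r i) s) l /\ l <= c.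

(* H^s(A) <= c  (H^s = sup_delta H^s_delta, H^s_delta = inf over delta-covers) *)
Definition Hs_le (n : nat) (s : R) (A : pt -> Prop) (c : R) : Prop :=
  forall delta eps, 0 < delta -> 0 < eps -> Hcover_bound n s delta A (c + eps).

Definition Hs_ge (n : nat) (s : R) (A : pt -> Prop) (c : R) : Prop :=
  forall c', c' < c -> ~ Hs_le n s A c'.

Definition Hs_finite (n : nat) (s : R) (A : pt -> Prop) : Prop :=
  exists c, Hs_le n s A c.

Definition hausdorff_dim (n : nat) (A : pt -> Prop) (d : R) : Prop :=
  (forall t, 0 <= t -> Hs_le n t A 0 -> d <= t) /\
  (forall b, (forall t, 0 <= t -> Hs_le n t A 0 -> b <= t) -> b <= d).

Definition inter (A B : pt -> Prop) (x : pt) : Prop := A x /\ B x.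

(* Lambda (the image of X in the unit sphere) is truly s-dimensional with
   constant K in condition (iv). *)
Definition truly_s_dim (n : nat) (s K : R) (L : pt -> Prop) : Prop :=
  (forall x, L x -> unit_sphere n x) /\
  hausdorff_dim n L s /\
  Hs_finite n s L /\
  (forall p, L p -> exists c r0, 0 < c /\ 0 < r0 /\
      forall r, 0 < r < r0 -> Hs_ge n s (inter L (eball n p r)) (c * Rpower r s)) /\
  0 < K /\
  (forall p r, L p -> 0 < r -> Hs_le n s (inter L (eball n p r)) (K * Rpower r s)).

Definition is_open_hyp (n : nat) (O : pt -> Prop) : Prop :=
  (forall x, O x -> unit_ball n x) /\
  (forall x, O x -> exists eps, 0 < eps /\
     forall y, inRn n y -> dist n y x < eps -> O y).

Definition hyp_boundary (n : nat) (O : pt -> Prop) (y : pt) : Prop :=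
  unit_ball n y /\ ~ O y /\
  forall eps, 0 < eps -> exists x, O x /\ dist n x y < eps.

(* ideal boundary of Omega: closure in the closed ball (= cone topology on
   H^n u boundary) intersected with the sphere *)
Definition ideal_boundary (n : nat) (O : pt -> Prop) (xi : pt) : Prop :=
  unit_sphere n xi /\ forall eps, 0 < eps -> exists x, O x /\ dist n x xi < eps.

Definition sphere_closure (n : nat) (L : pt -> Prop) (xi : pt) : Prop :=
  unit_sphere n xi /\ forall eps, 0 < eps -> exists y, L y /\ dist n y xi < eps.

(* Main.v *)
From Stdlib Require Import Reals Lra Lia Psatz Arith List FunctionalExtensionality.
From Stdlib Require Import Classical ClassicalEpsilon.
From mathcomp Require classical_sets filter.
Require Import Defs.
Open Scope R_scope.

(** With alpha = (n - 1) / 2 and the Poisson kernel P(x, xi) = (1 - |x|^2) / |x - xi|^2,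
    take u(x) to be the integral of P^alpha ln P over L against H^s, and
    Omega = {u > 0}.  The kernel is an eigenfunction because P^beta has eigenvalue
    beta (beta - (n - 1)), which is critical in beta at alpha.  Since |ln P| <= d(x, o),
    the decay estimate follows from the dyadic bound for the integral of P^alpha that
    condition (iv) gives.  Away from the closure of L one has P < 1 near the sphere, so
    u <= 0 there; on the radius to p in L, condition (iii) makes the part of the integral
    with P large, of order delta^(s - alpha) ln(1/delta), win over the part with P < 1, of
    order delta^(s/2) ln(1/delta), because s < 2 alpha.

    As L need not be measurable, integration against H^s is replaced by a mean J: a
    generalized limit of the discrete measures that put mass r_i^s at a point of U_i,
    for covers U_i of L whose cost tends to H^s(L).  The kernel and its derivatives are
    bounded uniformly in xi, so J commutes with differentiation in x. *)

(** * Euclidean vectors *)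

(** P^alpha alone is a positive eigenfunction, so it cuts out no domain; the factor ln P supplies
    the sign change, being positive inside the horosphere P = 1 through [o] and negative outside. It
    arises by differentiating Delta P^beta = beta (beta - (n - 1)) P^beta in beta: the extra term (2
    beta - (n - 1)) P^beta vanishes exactly at alpha.

    The delicate point about [J] is the two-sided comparison with H^s. The masses of a fine cover
    are easily bounded below by H^s, but a careless cover may waste mass on a small set; only the
    near-minimality of its total cost excludes this. A piece of a cover may straddle the border of a
    set, so each comparison passes from a set to a slight enlargement, and the ball conditions (iii)
    and (iv) absorb the change of radius. The masses need not converge along the covers, whence a
    limit along an ultrafilter. [J] is linear and positive but not claimed to be countably additive:
    finite dyadic sums and Taylor remainders uniform in xi take the place of convergence
    theorems. *)

Lemma rsum_ext (n : nat) (f g : nat -> R) :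
  (forall i, (i < n)%nat -> f i = g i) -> rsum n f = rsum n g.
Proof.
  induction n as [|n IH]; intros H; simpl; [reflexivity|].
  rewrite IH by (intros; apply H; lia). rewrite H by lia. reflexivity.
Qed.

Lemma rsum_plus (n : nat) (f g : nat -> R) :
  rsum n (fun i => f i + g i) = rsum n f + rsum n g.
Proof. induction n as [|n IH]; simpl; [|rewrite IH]; ring. Qed.

Lemma rsum_scal (n : nat) (c : R) (f : nat -> R) :
  rsum n (fun i => c * f i) = c * rsum n f.
Proof. induction n as [|n IH]; simpl; [|rewrite IH]; ring. Qed.

Lemma rsum_const (n : nat) (c : R) : rsum n (fun _ => c) = INR n * c.
Proof. induction n as [|n IH]; [simpl; ring|]. rewrite S_INR. simpl. rewrite IH; ring. Qed.

Lemma rsum_le (n : nat) (f g : nat -> R) :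
  (forall i, (i < n)%nat -> f i <= g i) -> rsum n f <= rsum n g.
Proof.
  induction n as [|n IH]; intros H; simpl; [lra|].
  apply Rplus_le_compat; [apply IH; intros; apply H; lia | apply H; lia].
Qed.

Lemma rsum_nonneg (n : nat) (f : nat -> R) :
  (forall i, (i < n)%nat -> 0 <= f i) -> 0 <= rsum n f.
Proof.
  intros H. replace 0 with (rsum n (fun _ => 0)) by (rewrite rsum_const; ring).
  now apply rsum_le.
Qed.

Lemma rsum_widen (n m : nat) (f : nat -> R) :
  (forall i, 0 <= f i) -> (n <= m)%nat -> rsum n f <= rsum m f.
Proof.
  intros H Hnm. induction Hnm as [|m Hnm IH]; [lra|].
  simpl. specialize (H m). lra.
Qed.

Lemma rsum_abs (n : nat) (f : nat -> R) :
  Rabs (rsum n f) <= rsum n (fun i => Rabs (f i)).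
Proof.
  induction n as [|n IH]; simpl; [rewrite Rabs_R0; lra|].
  eapply Rle_trans; [apply Rabs_triang|lra].
Qed.

Lemma rsum_term_le (n : nat) (f : nat -> R) (i : nat) :
  (forall j, 0 <= f j) -> (i < n)%nat -> f i <= rsum n f.
Proof.
  intros H Hi.
  apply Rle_trans with (rsum (S i) f).
  - simpl. assert (0 <= rsum i f) by (apply rsum_nonneg; auto). lra.
  - apply rsum_widen; auto with arith.
Qed.

Lemma rsum_sum_f_R0 (n : nat) (f : nat -> R) : sum_f_R0 f n = rsum (S n) f.
Proof. induction n as [|n IH]; simpl; [ring|]. rewrite IH. simpl. ring. Qed.

Lemma rsum_sq_nonneg (n : nat) (x : pt) : 0 <= rsum n (fun i => x i ^ 2).
Proof. apply rsum_nonneg. intros; apply pow2_ge_0. Qed.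

Lemma vnorm_nonneg (n : nat) (x : pt) : 0 <= vnorm n x.
Proof. apply sqrt_pos. Qed.

Lemma vnorm_sq (n : nat) (x : pt) : vnorm n x ^ 2 = rsum n (fun i => x i ^ 2).
Proof. unfold vnorm. rewrite pow2_sqrt; [reflexivity|apply rsum_sq_nonneg]. Qed.

Lemma vnorm_le_of_sq (n : nat) (x : pt) (c : R) :
  0 <= c -> rsum n (fun i => x i ^ 2) <= c ^ 2 -> vnorm n x <= c.
Proof.
  intros Hc H. unfold vnorm. rewrite <- (sqrt_pow2 c Hc). now apply sqrt_le_1_alt.
Qed.

Lemma vnorm_ext (n : nat) (x y : pt) :
  (forall i, (i < n)%nat -> x i ^ 2 = y i ^ 2) -> vnorm n x = vnorm n y.
Proof. intros H. unfold vnorm. f_equal. now apply rsum_ext. Qed.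

Lemma rsum_sq_lin (n : nat) (x y : pt) (a b : R) :
  rsum n (fun i => (a * x i + b * y i) ^ 2) =
  a ^ 2 * rsum n (fun i => x i ^ 2) + 2 * a * b * rsum n (fun i => x i * y i)
  + b ^ 2 * rsum n (fun i => y i ^ 2).
Proof.
  rewrite <- !rsum_scal, <- !rsum_plus. apply rsum_ext. intros; ring.
Qed.

Lemma rsum_cauchy_schwarz (n : nat) (x y : pt) :
  rsum n (fun i => x i * y i) <= vnorm n x * vnorm n y.
Proof.
  pose proof (vnorm_sq n x) as Hx. pose proof (vnorm_sq n y) as Hy.
  pose proof (vnorm_nonneg n x) as Hx0. pose proof (vnorm_nonneg n y) as Hy0.
  pose proof (rsum_sq_lin n x y) as E. rewrite <- Hx, <- Hy in E.
  set (a := vnorm n x) in *. set (b := vnorm n y) in *.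
  set (p := rsum n (fun i => x i * y i)) in *.
  assert (H : forall u v, 0 <= u ^ 2 * a ^ 2 + 2 * u * v * p + v ^ 2 * b ^ 2).
  { intros u v. rewrite <- E. apply rsum_nonneg. intros; apply pow2_ge_0. }
  destruct (Req_dec b 0) as [Hb|Hb].
  - destruct (Req_dec a 0) as [Ha|Ha].
    + specialize (H 1 (-1)). rewrite Ha, Hb in *. lra.
    (* For b = 0 the form at (-p, a^2) equals -a^2 p^2, which forces p = 0. *)
    + specialize (H (- p) (a ^ 2)). rewrite Hb in *.
      assert (Ha2 : 0 < a ^ 2) by (apply pow_lt; lra).
      assert (p ^ 2 <= 0) by (apply (Rmult_le_reg_l _ _ _ Ha2); lra).
      pose proof (pow2_ge_0 p). assert (Hp : p * p = 0) by lra.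
      destruct (Rmult_integral _ _ Hp); lra.
  (* At (b^2, -p) the form factors as b^2 (a^2 b^2 - p^2). *)
  - assert (Hb2 : 0 < b ^ 2) by (apply pow_lt; lra). specialize (H (b ^ 2) (- p)).
    assert (H1 : p ^ 2 <= (a * b) ^ 2).
    { apply (Rmult_le_reg_l _ _ _ Hb2). lra. }
    assert (0 <= a * b) by now apply Rmult_le_pos.
    nra.
Qed.

Lemma vnorm_triangle (n : nat) (x y z : pt) :
  (forall i, (i < n)%nat -> z i = x i + y i) -> vnorm n z <= vnorm n x + vnorm n y.
Proof.
  intros H. pose proof (vnorm_nonneg n x) as Hx0. pose proof (vnorm_nonneg n y) as Hy0.
  apply vnorm_le_of_sq; [lra|].
  rewrite (rsum_ext n _ (fun i => (1 * x i + 1 * y i) ^ 2))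
    by (intros i Hi; rewrite H by exact Hi; ring).
  rewrite rsum_sq_lin, <- !vnorm_sq.
  pose proof (rsum_cauchy_schwarz n x y). nra.
Qed.

Lemma dist_nonneg (n : nat) (x y : pt) : 0 <= dist n x y.
Proof. apply vnorm_nonneg. Qed.

Lemma dist_sym (n : nat) (x y : pt) : dist n x y = dist n y x.
Proof. apply vnorm_ext. intros; unfold vsub; ring. Qed.

Lemma dist_triangle (n : nat) (x y z : pt) : dist n x z <= dist n x y + dist n y z.
Proof. apply vnorm_triangle. intros; unfold vsub; ring. Qed.

Lemma dist_refl (n : nat) (x : pt) : dist n x x = 0.
Proof.
  apply Rle_antisym; [|apply dist_nonneg]. apply vnorm_le_of_sq; [lra|].
  rewrite (rsum_ext n _ (fun _ => 0)) by (intros; unfold vsub; ring).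
  rewrite rsum_const. lra.
Qed.

Lemma dist_origin (n : nat) (x : pt) : dist n x origin = vnorm n x.
Proof. apply vnorm_ext. intros; unfold vsub, origin; ring. Qed.

Lemma vnorm_origin (n : nat) : vnorm n origin = 0.
Proof. rewrite <- dist_origin. apply dist_refl. Qed.

Lemma vnorm_le_dist (n : nat) (x y : pt) : vnorm n x <= vnorm n y + dist n x y.
Proof. apply vnorm_triangle. intros; unfold vsub; ring. Qed.

Lemma coord_le_vnorm (n : nat) (x : pt) (i : nat) : (i < n)%nat -> Rabs (x i) <= vnorm n x.
Proof.
  intros Hi. unfold vnorm. rewrite <- sqrt_Rsqr_abs. apply sqrt_le_1_alt.
  rewrite Rsqr_pow2. apply (rsum_term_le n (fun i => x i ^ 2)); [|exact Hi].
  intros; apply pow2_ge_0.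
Qed.

Lemma shift_0 (x : pt) (i : nat) : shift x i 0 = x.
Proof.
  apply functional_extensionality. intros j. unfold shift. destruct (Nat.eqb j i); ring.
Qed.

Lemma shift_inRn (n : nat) (x : pt) (i : nat) (t : R) :
  (i < n)%nat -> inRn n x -> inRn n (shift x i t).
Proof.
  intros Hi Hx j Hj. unfold shift. destruct (Nat.eqb_spec j i); [lia|now apply Hx].
Qed.

Lemma rsum_shift (n : nat) (g : nat -> R -> R) (x : pt) (i : nat) (t : R) : (i < n)%nat ->
  rsum n (fun j => g j (shift x i t j)) = rsum n (fun j => g j (x j)) - g i (x i) + g i (x i + t).
Proof.
  induction n as [|n IH]; intros Hi; [lia|]. simpl.
  destruct (Nat.eq_dec i n) as [->|Hne].
  - rewrite (rsum_ext n _ (fun j => g j (x j))).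
    + unfold shift. rewrite Nat.eqb_refl. ring.
    + intros j Hj. unfold shift. destruct (Nat.eqb_spec j n); [lia|reflexivity].
  - rewrite IH by lia. unfold shift at 1. destruct (Nat.eqb_spec n i); [lia|]. ring.
Qed.

Lemma dist_shift (n : nat) (x : pt) (i : nat) (t : R) :
  (i < n)%nat -> dist n (shift x i t) x = Rabs t.
Proof.
  intros Hi. unfold dist, vnorm, vsub.
  rewrite (rsum_shift n (fun j v => (v - x j) ^ 2)) by exact Hi.
  rewrite (rsum_ext n _ (fun _ => 0)) by (intros; ring). rewrite rsum_const.
  rewrite <- sqrt_Rsqr_abs. f_equal. unfold Rsqr. ring.
Qed.

(** * A generalized limit *)

(** The ultrafilter lemma is applied to the filter of cofinite sets; since every tail then belongs
    to [W], each member of [W] meets every tail, which is the last clause. *)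
Lemma free_ultrafilter : exists W : (nat -> Prop) -> Prop,
  (forall P Q : nat -> Prop, (forall k, P k -> Q k) -> W P -> W Q) /\
  (forall P Q : nat -> Prop, W P -> W Q -> W (fun k => P k /\ Q k)) /\
  (forall P : nat -> Prop, W P \/ W (fun k => ~ P k)) /\
  (forall P : nat -> Prop, W P -> forall m, exists k, (m <= k)%nat /\ P k).
Proof.
  pose (F := fun P : nat -> Prop => exists m, forall k, (m <= k)%nat -> P k).
  assert (PF : @filter.ProperFilter nat F).
  { split.
    - intros [m Hm]. exact (Hm m (le_n m)).
    - split.
      + exists O. intros k _. exact I.
      + intros P Q [a Ha] [b Hb]. exists (a + b)%nat. intros k Hk.
        split; [apply Ha | apply Hb]; lia.
      + intros P Q HPQ [a Ha]. exists a. intros k Hk. apply HPQ. now apply Ha. }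
  destruct (@filter.ultraFilterLemma nat F PF) as [W [UW FW]].
  pose proof (@filter.ultra_proper _ _ UW) as PW.
  pose proof (@filter.filter_filter _ _ PW) as WW.
  assert (Hne : forall P : nat -> Prop, W P -> exists k, P k).
  { intros P HP. apply NNPP. intros Hn. apply (@filter.filter_not_empty _ _ PW).
    apply (@filter.filterS _ _ WW P); [|exact HP]. intros k Hk. apply Hn. now exists k. }
  assert (HI : forall P Q : nat -> Prop, W P -> W Q -> W (fun k => P k /\ Q k)).
  { intros P Q HP HQ. exact (@filter.filterI _ _ WW P Q HP HQ). }
  exists W. split; [|split; [|split]].
  - intros P Q HPQ HP. exact (@filter.filterS _ _ WW P Q HPQ HP).
  - exact HI.
  - intros P. destruct (@filter.in_ultra_setVsetC nat W P UW) as [H|H]; [now left|now right].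
  - intros P HP m.
    assert (Hm : W (fun k => (m <= k)%nat)) by (apply FW; exists m; auto).
    destruct (Hne _ (HI _ _ Hm HP)) as [k Hk]. now exists k.
Qed.

(** The limit along the free ultrafilter. The last two clauses let a strict inequality for the limit
    be realized at arbitrarily late indices, where the covers are as fine and as economical as
    desired. *)
Lemma generalized_limit : exists lim : (nat -> R) -> R,
  (forall (a b : nat -> R) C c, (forall k, Rabs (a k) <= C) -> (forall k, Rabs (b k) <= C) ->
     lim (fun k => a k + c * b k) = lim a + c * lim b) /\
  (forall a c C, (forall k, Rabs (a k) <= C) -> (forall k, c <= a k) -> c <= lim a) /\
  (forall a c C, (forall k, Rabs (a k) <= C) -> c < lim a ->
     forall m, exists k, (m <= k)%nat /\ c < a k) /\
  (forall a c C, (forall k, Rabs (a k) <= C) -> lim a < c ->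
     forall m, exists k, (m <= k)%nat /\ a k < c).
Proof.
  destruct free_ultrafilter as [W [HS [HI [HU Hinf]]]].
  pose (isl := fun (a : nat -> R) l => forall eps, 0 < eps -> W (fun k => Rabs (a k - l) < eps)).
  assert (Hex : forall a, exists l, forall C, (forall k, Rabs (a k) <= C) -> isl a l).
  { intros a. destruct (classic (exists C, forall k, Rabs (a k) <= C)) as [[C HC]|Hn].
    (* A default for unbounded sequences, which makes [lim] total; every clause assumes a bound. *)
    2:{ exists 0. intros C HC. exfalso. apply Hn. now exists C. }
    (* The limit is the supremum of those x that stay below the sequence on a member of [W]. *)
    pose (E := fun x => W (fun k => x <= a k)).
    assert (HT : W (fun _ => True)).
    { destruct (HU (fun _ => True)) as [H|H]; [exact H|].
      destruct (Hinf _ H O) as [k [_ Hk]]. tauto. }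
    destruct (completeness E) as [l [Hub Hlub]].
    - exists C. intros x Hx. destruct (Hinf _ Hx O) as [k [_ Hk]].
      specialize (HC k). pose proof (Rle_abs (a k)); pose proof (Rle_abs (- a k)); rewrite Rabs_Ropp in *; lra.
    - exists (- C). apply (HS (fun _ => True)); [|exact HT].
      intros k _. specialize (HC k). pose proof (Rle_abs (a k)); pose proof (Rle_abs (- a k)); rewrite Rabs_Ropp in *; lra.
    - exists l. intros C' _ eps Heps.
      assert (H1 : W (fun k => l - eps < a k)).
      { destruct (classic (exists x, E x /\ l - eps < x)) as [[x [Hx Hlx]]|Hn].
        - apply (HS (fun k => x <= a k)); [|exact Hx]. intros k Hk; lra.
        - exfalso. assert (l <= l - eps); [|lra]. apply Hlub. intros x Hx.
          apply Rnot_lt_le. intros Hlt. apply Hn. now exists x. }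
      assert (H2 : W (fun k => a k < l + eps)).
      { destruct (HU (fun k => l + eps <= a k)) as [H|H].
        - specialize (Hub _ H). lra.
        - apply (HS (fun k => ~ l + eps <= a k)); [|exact H]. intros k Hk; lra. }
      apply (HS (fun k => l - eps < a k /\ a k < l + eps)); [|now apply HI].
      intros k [Ha Hb]. apply Rabs_def1; lra. }
  pose (lim := fun a => proj1_sig (constructive_indefinite_description _ (Hex a))).
  assert (Hlim : forall a C, (forall k, Rabs (a k) <= C) -> isl a (lim a)).
  { intros a C HC. exact (proj2_sig (constructive_indefinite_description _ (Hex a)) C HC). }
  exists lim. split; [|split; [|split]].
  - intros a b C c Ha Hb.
    assert (Hab : forall k, Rabs (a k + c * b k) <= C + Rabs c * C).
    { intros k. eapply Rle_trans; [apply Rabs_triang|]. rewrite Rabs_mult.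
      apply Rplus_le_compat; [apply Ha|]. apply Rmult_le_compat_l; [apply Rabs_pos|apply Hb]. }
    pose proof (Hlim _ _ Ha) as La. pose proof (Hlim _ _ Hb) as Lb. pose proof (Hlim _ _ Hab) as Lab.
    set (x := lim (fun k => a k + c * b k)) in *. set (y := lim a) in *. set (z := lim b) in *.
    apply NNPP. intros Hne.
    assert (Hpos : 0 < Rabs (x - (y + c * z))) by (apply Rabs_pos_lt; lra).
    pose proof (Rabs_pos c) as Hc.
    set (e := Rabs (x - (y + c * z))) in *.
    (* At a common index the three errors add up to less than (2 + |c|) [eps], which is below
       [e]. *)
    pose (eps := e / (3 + Rabs c)).
    assert (Heps : 0 < eps) by (apply Rdiv_lt_0_compat; lra).
    assert (Hee : eps * (3 + Rabs c) = e) by (unfold eps; field; lra).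
    destruct (Hinf _ (HI _ _ (La eps Heps) (HI _ _ (Lb eps Heps) (Lab eps Heps))) O)
      as [k [_ [Ka [Kb Kab]]]].
    assert (e <= Rabs (x - (a k + c * b k)) + (Rabs (a k - y) + Rabs c * Rabs (b k - z))).
    { unfold e. rewrite <- Rabs_mult.
      replace (x - (y + c * z)) with ((x - (a k + c * b k)) + ((a k - y) + c * (b k - z))) by ring.
      eapply Rle_trans; [apply Rabs_triang|]. apply Rplus_le_compat_l. apply Rabs_triang. }
    rewrite (Rabs_minus_sym x) in H.
    assert (Rabs c * Rabs (b k - z) <= Rabs c * eps) by (apply Rmult_le_compat_l; lra).
    nra.
  - intros a c C HC Hca. apply Rnot_lt_le. intros Hlt.
    assert (Heps : 0 < c - lim a) by lra.
    destruct (Hinf _ (Hlim _ _ HC _ Heps) O) as [k [_ Hk]].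
    apply Rabs_def2 in Hk. specialize (Hca k). lra.
  - intros a c C HC Hlt m. assert (Heps : 0 < lim a - c) by lra.
    destruct (Hinf _ (Hlim _ _ HC _ Heps) m) as [k [Hm Hk]]. exists k. split; [exact Hm|].
    apply Rabs_def2 in Hk. lra.
  - intros a c C HC Hlt m. assert (Heps : 0 < c - lim a) by lra.
    destruct (Hinf _ (Hlim _ _ HC _ Heps) m) as [k [Hm Hk]]. exists k. split; [exact Hm|].
    apply Rabs_def2 in Hk. lra.
Qed.

(** * The mean attached to Hausdorff measure *)

Lemma functional_choice_eps (A B : Type) (P : A -> B -> Prop) :
  (forall a, exists b, P a b) -> exists f : A -> B, forall a, P a (f a).
Proof.
  intros H. exists (fun a => proj1_sig (constructive_indefinite_description _ (H a))).
  intros a. apply proj2_sig.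
Qed.

Lemma Rpower_pos (x y : R) : 0 < Rpower x y.
Proof. apply exp_pos. Qed.

Definition weight (s r : R) : R := if Rlt_dec 0 r then Rpower r s else 0.

Lemma weight_nonneg (s r : R) : 0 <= weight s r.
Proof. unfold weight. destruct (Rlt_dec 0 r); [left; apply Rpower_pos|lra]. Qed.

(* Covers in which radius 0 marks an unused index, so that families of sets
   can be thinned out and merged freely. *)
Definition weak_cover (n : nat) (s delta : R) (A : pt -> Prop) (c : R) : Prop :=
  exists (U : nat -> pt -> Prop) (r : nat -> R),
    (forall x, A x -> exists i, U i x) /\
    (forall i, 0 <= r i <= delta) /\
    (forall i x, U i x -> 0 < r i) /\
    (forall i x y, U i x -> U i y -> dist n x y <= r i) /\
    (forall N, rsum N (fun i => weight s (r i)) <= c).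

Lemma weak_cover_mono (n : nat) (s d d' : R) (A : pt -> Prop) (c c' : R) :
  d <= d' -> c <= c' -> weak_cover n s d A c -> weak_cover n s d' A c'.
Proof.
  intros Hd Hc [U [r [H1 [H2 [H3 [H4 H5]]]]]]. exists U, r.
  repeat split; auto; try apply H2.
  - apply Rle_trans with d; [apply H2|exact Hd].
  - intros N. apply Rle_trans with c; auto.
Qed.

Lemma partial_sum_le (f : nat -> R) (l : R) : (forall i, 0 <= f i) -> infinite_sum f l ->
  forall N, rsum N f <= l.
Proof.
  intros Hf Hl N. apply Rle_trans with (rsum (S N) f); [apply rsum_widen; auto|].
  rewrite <- rsum_sum_f_R0. apply growing_ineq; [|exact Hl].
  intros k. simpl. specialize (Hf (S k)). lra.
Qed.

Lemma partial_sum_approx (f : nat -> R) (l e : R) : infinite_sum f l -> 0 < e ->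
  exists N, l - e <= rsum N f.
Proof.
  intros Hl He. destruct (Hl e He) as [N HN]. exists (S N).
  specialize (HN N (le_n N)). rewrite rsum_sum_f_R0 in HN.
  apply Rabs_def2 in HN. lra.
Qed.

Lemma infinite_sum_of_bounded (f : nat -> R) (c : R) :
  (forall i, 0 <= f i) -> (forall N, rsum N f <= c) -> exists l, infinite_sum f l /\ l <= c.
Proof.
  intros Hf Hc. destruct (growing_cv (sum_f_R0 f)) as [l Hl].
  - intros k. simpl. specialize (Hf (S k)). lra.
  - exists c. intros x [k ->]. rewrite rsum_sum_f_R0. apply Hc.
  - exists l. split; [exact Hl|].
    apply Rnot_lt_le. intros Hlt. destruct (partial_sum_approx f l ((l - c) / 2) Hl) as [N HN]; [lra|].
    specialize (Hc N). lra.
Qed.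

Lemma Hcover_bound_weak (n : nat) (s d : R) (A : pt -> Prop) (c : R) :
  Hcover_bound n s d A c -> weak_cover n s d A c.
Proof.
  intros [U [r [H1 [H2 [H3 [l [Hl Hlc]]]]]]]. exists U, r.
  split; [exact H1|]. split; [intros i; specialize (H2 i); lra|].
  split; [intros i x _; apply H2|]. split; [exact H3|].
  intros N. apply Rle_trans with l; [|exact Hlc].
  rewrite (rsum_ext N _ (fun i => Rpower (r i) s)).
  - apply partial_sum_le; [intros i; left; apply Rpower_pos|exact Hl].
  - intros i _. unfold weight. destruct (Rlt_dec 0 (r i)) as [h|h]; [reflexivity|].
    destruct (H2 i); contradiction.
Qed.

Lemma weak_cover_Hcover_bound (n : nat) (s d : R) (A : pt -> Prop) (c eps : R) :
  0 < s -> 0 < d -> 0 < eps -> weak_cover n s d A c -> Hcover_bound n s d A (c + eps).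
Proof.
  intros Hs Hd He [U [r [H1 [H2 [H3 [H4 H5]]]]]].
  pose (g := fun i => eps * (/ 2) ^ S i).
  assert (Hg : forall i, 0 < g i) by (intros i; apply Rmult_lt_0_compat; [lra|apply pow_lt; lra]).
  assert (Hgs : forall N, rsum N g = eps * (1 - (/ 2) ^ N)).
  { induction N as [|N IH]; [simpl; ring|]. simpl. rewrite IH. unfold g. simpl. field. }
  (* The radius g_i^(1/s) costs exactly g_i, and the g_i sum to less than [eps]; the minimum with
     [d] keeps the cover fine. *)
  pose (r' := fun i => if Rlt_dec 0 (r i) then r i else Rmin d (Rpower (g i) (/ s))).
  assert (Hr' : forall i, 0 < r' i <= d).
  { intros i. unfold r'. destruct (Rlt_dec 0 (r i)); [split; [auto|apply H2]|].
    split; [apply Rmin_pos; [auto|apply Rpower_pos]|apply Rmin_l]. }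
  assert (Hw : forall i, Rpower (r' i) s <= weight s (r i) + g i).
  { intros i. specialize (Hr' i). unfold weight, r' in *. destruct (Rlt_dec 0 (r i)).
    - specialize (Hg i). lra.
    - rewrite Rplus_0_l.
      apply Rle_trans with (Rpower (Rpower (g i) (/ s)) s).
      + apply Rle_Rpower_l; [lra|]. split; [lra|apply Rmin_r].
      + rewrite Rpower_mult, Rinv_l by lra. rewrite Rpower_1 by auto. lra. }
  exists U, r'. split; [exact H1|]. split; [exact Hr'|]. split.
  - intros i x y Hx Hy. unfold r'. destruct (Rlt_dec 0 (r i)) as [h|h]; [now apply H4|].
    exfalso. apply h. now apply (H3 i x).
  - apply infinite_sum_of_bounded; [intros i; left; apply Rpower_pos|].
    intros N. eapply Rle_trans; [apply rsum_le; intros i _; apply Hw|].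
    rewrite rsum_plus, Hgs. specialize (H5 N).
    assert (0 < (/ 2) ^ N) by (apply pow_lt; lra). nra.
Qed.

Lemma Hs_le_of_weak (n : nat) (s : R) (A : pt -> Prop) (c : R) : 0 < s ->
  (forall d eps, 0 < d -> 0 < eps -> weak_cover n s d A (c + eps)) -> Hs_le n s A c.
Proof.
  intros Hs H d eps Hd He. replace (c + eps) with (c + eps / 2 + eps / 2) by field.
  apply weak_cover_Hcover_bound; try lra. apply H; lra.
Qed.

Lemma Hs_le_weak (n : nat) (s : R) (A : pt -> Prop) (c d eps : R) :
  Hs_le n s A c -> 0 < d -> 0 < eps -> weak_cover n s d A (c + eps).
Proof. intros H Hd He. apply Hcover_bound_weak. now apply H. Qed.

Lemma Hs_le_nonneg (n : nat) (s : R) (A : pt -> Prop) (c : R) : Hs_le n s A c -> 0 <= c.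
Proof.
  intros H. apply Rnot_lt_le. intros Hc.
  destruct (Hs_le_weak n s A c 1 (- c / 2) H) as [U [r [_ [_ [_ [_ H5]]]]]]; try lra.
  specialize (H5 O). simpl in H5. lra.
Qed.

Lemma rsum_even_odd (N : nat) (f : nat -> R) :
  rsum (2 * N) f = rsum N (fun i => f (2 * i)%nat) + rsum N (fun i => f (S (2 * i))).
Proof.
  induction N as [|N IH]; [simpl; ring|].
  replace (2 * S N)%nat with (S (S (2 * N))) by lia. cbn [rsum]. rewrite IH. ring.
Qed.

(** A cover of [A] on the even indices and one of [B] on the odd indices are interleaved. *)
Lemma Hs_le_union (n : nat) (s : R) (A B C : pt -> Prop) (a b : R) : 0 < s ->
  (forall x, C x -> A x \/ B x) -> Hs_le n s A a -> Hs_le n s B b -> Hs_le n s C (a + b).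
Proof.
  intros Hs HC HA HB. apply Hs_le_of_weak; [exact Hs|]. intros d eps Hd He.
  destruct (Hs_le_weak n s A a d (eps / 2) HA) as [U [r [U1 [U2 [U3 [U4 U5]]]]]]; try lra.
  destruct (Hs_le_weak n s B b d (eps / 2) HB) as [V [q [V1 [V2 [V3 [V4 V5]]]]]]; try lra.
  exists (fun i => if Nat.even i then U (Nat.div2 i) else V (Nat.div2 i)).
  exists (fun i => if Nat.even i then r (Nat.div2 i) else q (Nat.div2 i)).
  assert (E : forall i, Nat.even (2 * i) = true) by (intros i; rewrite Nat.even_mul; reflexivity).
  assert (Ho : forall i, Nat.even (S (2 * i)) = false)
    by (intros i; rewrite Nat.even_succ, <- Nat.negb_even, E; reflexivity).
  split; [|split; [|split; [|split]]].
  - intros x Hx. destruct (HC x Hx) as [Hx'|Hx'].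
    + destruct (U1 x Hx') as [i Hi]. exists (2 * i)%nat. now rewrite E, Nat.div2_double.
    + destruct (V1 x Hx') as [i Hi]. exists (S (2 * i))%nat. now rewrite Ho, Nat.div2_succ_double.
  - intros i. destruct (Nat.even i); auto.
  - intros i x. destruct (Nat.even i); eauto.
  - intros i x y. destruct (Nat.even i); eauto.
  - intros N. apply Rle_trans with (rsum (2 * N) (fun i => weight s
        (if Nat.even i then r (Nat.div2 i) else q (Nat.div2 i)))).
    + apply rsum_widen; [|lia]. intros; apply weight_nonneg.
    + rewrite rsum_even_odd.
      rewrite (rsum_ext N _ (fun i => weight s (r i))) by (intros; now rewrite E, Nat.div2_double).
      rewrite (rsum_ext N (fun i => weight s (if Nat.even (S (2 * i)) then _ else _))
        (fun i => weight s (q i))) by (intros; now rewrite Ho, Nat.div2_succ_double).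
      specialize (U5 N). specialize (V5 N). lra.
Qed.

Definition ind (A : pt -> Prop) (y : pt) : R := if excluded_middle_informative (A y) then 1 else 0.

Lemma ind_true (A : pt -> Prop) (y : pt) : A y -> ind A y = 1.
Proof. intros H. unfold ind. destruct (excluded_middle_informative (A y)); tauto. Qed.

Lemma ind_false (A : pt -> Prop) (y : pt) : ~ A y -> ind A y = 0.
Proof. intros H. unfold ind. destruct (excluded_middle_informative (A y)); tauto. Qed.

Lemma ind_bounds (A : pt -> Prop) (y : pt) : 0 <= ind A y <= 1.
Proof. unfold ind. destruct (excluded_middle_informative (A y)); lra. Qed.

(** Only the sets that meet [B] are kept; the others are emptied and get radius 0, so they cost
    nothing. *)
Lemma subfamily_cover (n : nat) (s d : R) (U : nat -> pt -> Prop) (r : nat -> R)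
  (L B : pt -> Prop) (c : R) :
  (forall x, L x -> exists i, U i x) -> (forall x, B x -> L x) ->
  (forall i, 0 < r i <= d) -> (forall i x y, U i x -> U i y -> dist n x y <= r i) ->
  (forall N, rsum N (fun i =>
     if excluded_middle_informative (exists x, U i x /\ B x) then Rpower (r i) s else 0) <= c) ->
  weak_cover n s d B c.
Proof.
  intros HL HB Hr Hd HN.
  exists (fun i x => U i x /\ B x).
  exists (fun i => if excluded_middle_informative (exists x, U i x /\ B x) then r i else 0).
  split; [|split; [|split; [|split]]].
  - intros x Hx. destruct (HL x (HB x Hx)) as [i Hi]. now exists i.
  - intros i. destruct (excluded_middle_informative _); specialize (Hr i); lra.
  - intros i x Hx. destruct (excluded_middle_informative _) as [h|h]; [apply Hr|].
    exfalso. apply h. now exists x.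
  - intros i x y Hx Hy. destruct (excluded_middle_informative _) as [h|h]; [apply Hd; tauto|].
    exfalso. apply h. now exists x.
  - intros N. erewrite rsum_ext; [apply HN|]. intros i _. cbv beta.
    destruct (excluded_middle_informative _) as [h|h]; unfold weight.
    + destruct (Rlt_dec 0 (r i)) as [h'|h']; [reflexivity|]. destruct (Hr i); contradiction.
    + destruct (Rlt_dec 0 0); lra.
Qed.

Lemma Hs_value (n : nat) (s : R) (L : pt -> Prop) : Hs_finite n s L ->
  exists H, (forall e, 0 < e -> Hs_le n s L (H + e)) /\ (forall c, c < H -> ~ Hs_le n s L c).
Proof.
  intros [c0 Hc0]. destruct (completeness (fun x => Hs_le n s L (- x))) as [h [Hub Hlub]].
  - exists 0. intros x Hx. apply Hs_le_nonneg in Hx. lra.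
  - exists (- c0). now rewrite Ropp_involutive.
  - exists (- h). split.
    + intros e He.
      destruct (classic (exists x, h - e < x /\ Hs_le n s L (- x))) as [[x [Hx HL]]|Hn].
      * intros d eps Hd Heps. replace (- h + e + eps) with (- x + (eps + (x - h + e))) by ring.
        apply HL; lra.
      * exfalso. assert (h <= h - e); [|lra]. apply Hlub. intros x Hx.
        apply Rnot_lt_le. intros Hlt. apply Hn. now exists x.
    + intros c Hc HL. rewrite <- (Ropp_involutive c) in HL. specialize (Hub _ HL). lra.
Qed.

(* A cover of L of cost close to H = H^s(L) puts masses r_i^s at points of L.
   By the last clause near-optimality bounds this mass from above: were it too
   large on A, the rest of L would be covered too cheaply. *)
Lemma near_optimal_measure (n : nat) (s H e : R) (L : pt -> Prop) :
  0 < e -> Hs_le n s L (H + e) ->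
  exists m : (pt -> R) -> R,
    (forall f g c, m (fun y => f y + c * g y) = m f + c * m g) /\
    (forall f C, 0 <= C -> (forall y, L y -> Rabs (f y) <= C) -> Rabs (m f) <= C * (H + 2 * e)) /\
    (forall f, (forall y, L y -> 0 <= f y) -> 0 <= m f) /\
    (forall A A' : pt -> Prop,
       (forall x y, L x -> L y -> A x -> dist n x y <= e -> A' y) ->
       weak_cover n s e (inter L A) (m (ind A') + e) /\
       weak_cover n s e (fun y => L y /\ ~ A' y) (H + 2 * e - m (ind A))).
Proof.
  intros He HL. destruct (HL e e He He) as [U [r [H1 [H2 [H3 [l [Hl Hlc]]]]]]].
  pose (p := fun i => Rpower (r i) s).
  assert (Hp : forall i, 0 < p i) by (intros; apply Rpower_pos).
  assert (Hsum : forall N, rsum N p <= l) by (apply partial_sum_le; [intros; left; auto|exact Hl]).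
  (* Only the first [N] sets will carry mass, so that the measure is a finite sum; the remaining
     ones cost at most [e] together. *)
  destruct (partial_sum_approx p l e Hl He) as [N HN].
  destruct (functional_choice_eps _ _ (fun i y => (U i y /\ L y) \/ ~ exists z, U i z /\ L z)) as [y Hy].
  { intros i. destruct (classic (exists z, U i z /\ L z)) as [[z Hz]|Hn].
    - exists z. now left.
    - exists origin. now right. }
  (* A set that misses [L] has the placeholder [origin] as its point, and the weight 0 removes
     it. *)
  pose (w := fun i => if excluded_middle_informative (U i (y i) /\ L (y i)) then p i else 0).
  assert (Hw : forall i, 0 <= w i <= p i).
  { intros i. specialize (Hp i). unfold w. destruct (excluded_middle_informative _); lra. }
  exists (fun f => rsum N (fun i => w i * f (y i))).
  split; [|split; [|split]].
  - intros f g c. rewrite <- rsum_scal, <- rsum_plus. apply rsum_ext. intros; ring.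
  - intros f C HC Hf. eapply Rle_trans; [apply rsum_abs|].
    apply Rle_trans with (rsum N (fun i => C * p i)).
    + apply rsum_le. intros i _. rewrite Rabs_mult, Rabs_pos_eq by apply Hw.
      unfold w. destruct (excluded_middle_informative _) as [h|h].
      * rewrite Rmult_comm. apply Rmult_le_compat_r; [left; auto|]. apply Hf, h.
      * rewrite Rmult_0_l. apply Rmult_le_pos; [lra|left; auto].
    + rewrite rsum_scal. apply Rmult_le_compat_l; [exact HC|]. specialize (Hsum N). lra.
  - intros f Hf. apply rsum_nonneg. intros i _. unfold w.
    destruct (excluded_middle_informative _) as [h|h]; [|lra].
    apply Rmult_le_pos; [left; auto|apply Hf, h].
  - intros A A' HAA. split.
    + apply (subfamily_cover n s e U r L); auto; [intros x [Hx _]; exact Hx|].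
      intros M. set (q := fun i => if excluded_middle_informative _ then _ else _).
      assert (Hq : forall i, 0 <= q i <= p i).
      { intros i. specialize (Hp i). unfold q. destruct (excluded_middle_informative _).
        - fold (p i). lra.
        - lra. }
      (* A set meeting [A] inside [L] has diameter at most [e], so its chosen point lies in [A'] and
         its cost is charged to the mass of [A']. *)
      assert (Hq' : forall i, q i <= w i * ind A' (y i)).
      { intros i. unfold q. destruct (excluded_middle_informative _) as [[x [Ux [Lx Ax]]]|h].
        - fold (p i). destruct (Hy i) as [[Uy Ly]|Hn].
          + rewrite ind_true.
            * unfold w. destruct (excluded_middle_informative _) as [h|h]; [lra|]. tauto.
            * apply (HAA x); auto. apply Rle_trans with (r i); [now apply (H3 i)|apply H2].
          + exfalso. apply Hn. now exists x.
        - apply Rmult_le_pos; [apply Hw|apply ind_bounds]. }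
      (* The tail beyond [N] accounts for the additional [e]. *)
      apply Rle_trans with (rsum N q + e).
      * destruct (Nat.le_ge_cases M N) as [HMN|HNM].
        -- assert (rsum M q <= rsum N q) by (apply rsum_widen; [apply Hq|exact HMN]). lra.
        -- assert (rsum N (fun i => p i + -1 * q i) <= rsum M (fun i => p i + -1 * q i)) as Hd.
           { apply rsum_widen; [|exact HNM]. intros i. specialize (Hq i). lra. }
           rewrite !rsum_plus, !rsum_scal in Hd. specialize (Hsum M). lra.
      * apply Rplus_le_compat_r. apply rsum_le. auto.
    + apply (subfamily_cover n s e U r L); auto; [intros x [Hx _]; exact Hx|].
      intros M. set (q := fun i => if excluded_middle_informative _ then _ else _).
      assert (Hq : forall i, 0 <= q i <= p i).
      { intros i. specialize (Hp i). unfold q. destruct (excluded_middle_informative _).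
        - fold (p i). lra.
        - lra. }
      (* A set that contains a point of [L] outside [A'] cannot have its chosen point in [A]. Hence
         the mass of [A] sits on discarded sets and can be deducted from the total cost. *)
      assert (Hq' : forall i, q i <= p i + -1 * (w i * ind A (y i))).
      { intros i. unfold q. destruct (excluded_middle_informative _) as [[x [Ux [Lx Ax]]]|h].
        - fold (p i). destruct (classic (A (y i))) as [hA|hA].
          + unfold w. destruct (excluded_middle_informative _) as [[Uy Ly]|h]; [|lra].
            exfalso. apply Ax. apply (HAA (y i)); auto.
            apply Rle_trans with (r i); [now apply (H3 i)|apply H2].
          + rewrite ind_false by exact hA. lra.
        - specialize (Hw i). pose proof (ind_bounds A (y i)). nra. }
      (* The deduction is made within the first [N] indices; beyond them the full cost [p] is
         allowed, and everything up to [K] still costs at most [l]. *)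
      pose (K := Nat.max M N).
      assert (rsum M q <= rsum K q) by (apply rsum_widen; [apply Hq|unfold K; lia]).
      assert (Hd : rsum N (fun i => p i + -1 * q i) <= rsum K (fun i => p i + -1 * q i)).
      { apply rsum_widen; [|unfold K; lia]. intros i. specialize (Hq i). lra. }
      assert (Hd' : rsum N q <= rsum N (fun i => p i + -1 * (w i * ind A (y i)))).
      { apply rsum_le. intros; apply Hq'. }
      rewrite !rsum_plus, !rsum_scal in *.
      specialize (Hsum K). lra.
Qed.

Definition bdd_on (L : pt -> Prop) (f : pt -> R) : Prop :=
  exists C, forall y, L y -> Rabs (f y) <= C.

Definition is_mean (L : pt -> Prop) (J : (pt -> R) -> R) : Prop :=
  (forall f g c, bdd_on L f -> bdd_on L g ->
     J (fun y => f y + c * g y) = J f + c * J g) /\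
  (forall f, bdd_on L f -> (forall y, L y -> 0 <= f y) -> 0 <= J f).

(** Lower bound: the sets meeting [A] cover it at a cost close to the mass of [A']. Upper bound:
    were the mass of [A] above c, then L minus [A'] could be covered for less than H - c, and adding
    a cover of [A'] of cost c would beat the optimal value H of [L]. *)
Lemma hausdorff_mean (n : nat) (s : R) (L : pt -> Prop) : 0 < s -> Hs_finite n s L ->
  exists J, is_mean L J /\
    forall (A A' : pt -> Prop) eta, 0 < eta ->
      (forall x y, L x -> L y -> A x -> dist n x y <= eta -> A' y) ->
      (forall c, Hs_le n s (inter L A') c -> J (ind A) <= c) /\
      (forall c, ~ Hs_le n s (inter L A) c -> c <= J (ind A')).
Proof.
  intros Hs Hfin. destruct (Hs_value n s L Hfin) as [H [HL Hopt]].
  (* The k-th cover has mesh and error 1/(k + 1); being at most 1, these errors give the bound H + 2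
     on all total masses. *)
  pose (e := fun k => / (INR k + 1)).
  assert (He : forall k, 0 < e k <= 1).
  { intros k. unfold e. pose proof (pos_INR k). split; [apply Rinv_0_lt_compat; lra|].
    rewrite <- Rinv_1. apply Rinv_le_contravar; lra. }
  assert (Hesmall : forall t, 0 < t -> exists m, forall k, (m <= k)%nat -> e k <= t).
  { intros t Ht. destruct (archimed_cor1 t Ht) as [m [Hm Hm0]]. exists m. intros k Hk.
    apply Rle_trans with (/ INR m); [|lra]. apply Rinv_le_contravar.
    - now apply lt_0_INR.
    - apply le_INR in Hk. lra. }
  assert (HH : 0 <= H).
  { apply Rnot_lt_le. intros Hneg. specialize (HL (- H / 2) ltac:(lra)).
    apply Hs_le_nonneg in HL. lra. }
  destruct (functional_choice_eps _ _ _ (fun k => near_optimal_measure n s H (e k) L (proj1 (He k))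
                                 (HL (e k) (proj1 (He k))))) as [m Hm].
  destruct generalized_limit as [lim [Llin [Lpos [Lgt Llt]]]].
  pose (J := fun f => lim (fun k => m k f)).
  assert (Hb : forall f C, (forall y, L y -> Rabs (f y) <= C) -> forall k,
             Rabs (m k f) <= Rmax 0 C * (H + 2)).
  { intros f C HC k. destruct (Hm k) as [_ [Hbd _]].
    eapply Rle_trans; [apply (Hbd f (Rmax 0 C)); [apply Rmax_l|]|].
    - intros y Hy. eapply Rle_trans; [now apply HC|apply Rmax_r].
    - apply Rmult_le_compat_l; [apply Rmax_l|]. specialize (He k). lra. }
  assert (Hind : forall A y, L y -> Rabs (ind A y) <= 1).
  { intros A y _. pose proof (ind_bounds A y). apply Rabs_le. lra. }
  exists J. split; [split|].
  - intros f g c [C HC] [C' HC']. unfold J.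
    rewrite <- (Llin _ _ (Rmax 0 (Rmax C C') * (H + 2)) c).
    + f_equal. apply functional_extensionality. intros k. apply Hm.
    + apply Hb. intros y Hy. eapply Rle_trans; [now apply HC|apply Rmax_l].
    + apply Hb. intros y Hy. eapply Rle_trans; [now apply HC'|apply Rmax_r].
  - intros f [C HC] Hf. apply (Lpos _ _ _ (Hb f C HC)). intros k. now apply Hm.
  - intros A A' eta Heta HAA. destruct (Hesmall eta Heta) as [m0 Hm0]. split.
    + intros c Hc. apply Rnot_lt_le. intros Hlt.
      (* The midpoint leaves room on both sides: c + (H - [c1]) < H contradicts optimality, and
         m_k(A) > [c1] holds for arbitrarily late k. *)
      pose (c1 := (c + J (ind A)) / 2).
      assert (Hc1 : c < c1 < J (ind A)) by (unfold c1; lra).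
      apply (Hopt (c + (H - c1))); [lra|].
      apply (Hs_le_union n s (inter L A') (fun y => L y /\ ~ A' y)); auto.
      * intros x Hx. destruct (classic (A' x)); [left; now split|now right].
      * apply Hs_le_of_weak; [exact Hs|]. intros d eps Hd Heps.
        destruct (Hesmall (Rmin d (eps / 2))) as [m1 Hm1]; [apply Rmin_pos; lra|].
        destruct (Lgt _ c1 _ (Hb (ind A) 1 (Hind A)) (proj2 Hc1) (m0 + m1)%nat) as [k [Hk Hck]].
        destruct (Hm k) as [_ [_ [_ Hcov]]].
        destruct (Hcov A A') as [_ HA].
        { intros x y Lx Ly Ax Hd'. apply (HAA x y); auto. specialize (Hm0 k ltac:(lia)). lra. }
        specialize (Hm1 k ltac:(lia)).
        pose proof (Rmin_l d (eps / 2)). pose proof (Rmin_r d (eps / 2)).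
        eapply weak_cover_mono; [| |exact HA]; lra.
    + intros c Hc. apply Rnot_lt_le. intros Hlt. apply Hc.
      apply Hs_le_of_weak; [exact Hs|]. intros d eps Hd Heps.
      destruct (Hesmall (Rmin d eps)) as [m1 Hm1]; [apply Rmin_pos; lra|].
      destruct (Llt _ c _ (Hb (ind A') 1 (Hind A')) Hlt (m0 + m1)%nat) as [k [Hk Hck]].
      destruct (Hm k) as [_ [_ [_ Hcov]]].
      destruct (Hcov A A') as [HA _].
      { intros x y Lx Ly Ax Hd'. apply (HAA x y); auto. specialize (Hm0 k ltac:(lia)). lra. }
      specialize (Hm1 k ltac:(lia)).
      pose proof (Rmin_l d eps). pose proof (Rmin_r d eps).
      eapply weak_cover_mono; [| |exact HA]; lra.
Qed.

(** * Differentiation of kernels under the mean *)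

Lemma bdd_on_lin (L : pt -> Prop) (f g : pt -> R) (c : R) :
  bdd_on L f -> bdd_on L g -> bdd_on L (fun y => f y + c * g y).
Proof.
  intros [C HC] [C' HC']. exists (C + Rabs c * C'). intros y Hy.
  eapply Rle_trans; [apply Rabs_triang|]. rewrite Rabs_mult.
  apply Rplus_le_compat; [auto|]. apply Rmult_le_compat_l; [apply Rabs_pos|auto].
Qed.

Lemma bdd_on_const (L : pt -> Prop) (c : R) : bdd_on L (fun _ => c).
Proof. exists (Rabs c). intros; lra. Qed.

Lemma bdd_on_scal (L : pt -> Prop) (f : pt -> R) (c : R) :
  bdd_on L f -> bdd_on L (fun y => c * f y).
Proof.
  intros Hf. destruct (bdd_on_lin L (fun _ => 0) f c (bdd_on_const L 0) Hf) as [C HC].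
  exists C. intros y Hy. rewrite <- (Rplus_0_l (c * f y)). auto.
Qed.

Lemma bdd_on_rsum (L : pt -> Prop) (N : nat) (F : nat -> pt -> R) :
  (forall i, (i < N)%nat -> bdd_on L (F i)) -> bdd_on L (fun y => rsum N (fun i => F i y)).
Proof.
  induction N as [|N IH]; intros H; simpl; [apply bdd_on_const|].
  destruct (bdd_on_lin L (fun y => rsum N (fun i => F i y)) (F N) 1) as [C HC]; auto.
  exists C. intros y Hy. rewrite <- (Rmult_1_l (F N y)). auto.
Qed.

Lemma bdd_on_ind (L A : pt -> Prop) : bdd_on L (ind A).
Proof. exists 1. intros y _. pose proof (ind_bounds A y). apply Rabs_le. lra. Qed.

Lemma mean_le (L : pt -> Prop) (J : (pt -> R) -> R) (f g : pt -> R) : is_mean L J ->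
  bdd_on L f -> bdd_on L g -> (forall y, L y -> f y <= g y) -> J f <= J g.
Proof.
  intros [Hl Hp] Hf Hg Hfg.
  assert (0 <= J (fun y => g y + -1 * f y)).
  { apply Hp; [now apply bdd_on_lin|]. intros y Hy. specialize (Hfg y Hy). lra. }
  rewrite Hl in H by auto. lra.
Qed.

(** Positivity is required of functions that are nonnegative on [L] only, and this already makes [J]
    blind to values off [L]. *)
Lemma mean_ext (L : pt -> Prop) (J : (pt -> R) -> R) (f g : pt -> R) : is_mean L J ->
  bdd_on L f -> (forall y, L y -> f y = g y) -> J f = J g.
Proof.
  intros HJ Hf Hfg. assert (Hg : bdd_on L g).
  { destruct Hf as [C HC]. exists C. intros y Hy. rewrite <- Hfg; auto. }
  apply Rle_antisym; apply (mean_le L); auto; intros y Hy; rewrite (Hfg y Hy); lra.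
Qed.

Lemma mean_scal (L : pt -> Prop) (J : (pt -> R) -> R) (f : pt -> R) (c : R) : is_mean L J ->
  bdd_on L f -> J (fun y => c * f y) = c * J f.
Proof.
  intros [Hl Hp] Hf.
  replace (fun y => c * f y) with (fun y => f y + (c - 1) * f y)
    by (apply functional_extensionality; intros; ring).
  rewrite Hl by auto. ring.
Qed.

Lemma mean_rsum (L : pt -> Prop) (J : (pt -> R) -> R) (N : nat) (F : nat -> pt -> R) :
  is_mean L J -> (forall i, (i < N)%nat -> bdd_on L (F i)) ->
  J (fun y => rsum N (fun i => F i y)) = rsum N (fun i => J (F i)).
Proof.
  intros HJ. induction N as [|N IH]; intros H; simpl.
  - replace (fun _ : pt => 0) with (fun _ : pt => 0 * 1)
      by (apply functional_extensionality; intros; ring).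
    rewrite (mean_scal L J (fun _ => 1)) by (auto; apply bdd_on_const). ring.
  - rewrite <- IH by auto.
    replace (fun y => rsum N (fun i => F i y) + F N y)
      with (fun y => rsum N (fun i => F i y) + 1 * F N y)
      by (apply functional_extensionality; intros; ring).
    destruct HJ as [Hl _]. rewrite Hl; [ring| |auto].
    apply bdd_on_rsum; auto.
Qed.

Lemma mean_abs_le (L : pt -> Prop) (J : (pt -> R) -> R) (f : pt -> R) (C : R) :
  is_mean L J -> (forall y, L y -> Rabs (f y) <= C) -> Rabs (J f) <= C * J (fun _ => 1).
Proof.
  intros HJ HC.
  assert (Hf : bdd_on L f) by now exists C.
  assert (H1 : forall c, J (fun _ => c) = c * J (fun _ => 1)).
  { intros c. rewrite <- (mean_scal L J (fun _ => 1) c HJ (bdd_on_const L 1)).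
    f_equal. apply functional_extensionality. intros; ring. }
  apply Rabs_le. split.
  - replace (- (C * J (fun _ => 1))) with (J (fun _ => - C)) by (rewrite H1; ring).
    apply (mean_le L); auto using bdd_on_const. intros y Hy. specialize (HC y Hy).
    pose proof (Rle_abs (- f y)). rewrite Rabs_Ropp in *. lra.
  - rewrite <- H1. apply (mean_le L); auto using bdd_on_const. intros y Hy.
    specialize (HC y Hy). pose proof (Rle_abs (f y)). lra.
Qed.

(** * A formal calculus of kernels *)

Definition bdy_defect (n : nat) (x : pt) : R := 1 - rsum n (fun i => x i ^ 2).
Definition dist2 (n : nat) (x y : pt) : R := rsum n (fun i => (x i - y i) ^ 2).
Definition poisson (n : nat) (x y : pt) : R := bdy_defect n x / dist2 n x y.

(* A class of kernels F(x, xi) closed under differentiation in x. With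
   A = 1 - |x|^2 and B = |x - xi|^2, [EIA] and [EIB] stand for 1/A and 1/B,
   [EG] for (A/B)^alpha and [ELg] for ln (A/B). *)
Inductive expr : Type :=
  | ECst (c : R) | EX (i : nat) | EY (i : nat) | EIA | EIB | EG | ELg
  | EAdd (e1 e2 : expr) | EMul (e1 e2 : expr).

Fixpoint ev (n : nat) (alpha : R) (e : expr) (x y : pt) : R :=
  match e with
  | ECst c => c
  | EX i => x i
  | EY i => y i
  | EIA => / bdy_defect n x
  | EIB => / dist2 n x y
  | EG => exp (alpha * ln (poisson n x y))
  | ELg => ln (poisson n x y)
  | EAdd e1 e2 => ev n alpha e1 x y + ev n alpha e2 x y
  | EMul e1 e2 => ev n alpha e1 x y * ev n alpha e2 x y
  end.

(** The derivative of ln A - ln B in direction i, that is -2 x_i / A - 2 (x_i - xi_i) / B. *)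
Definition dlog (i : nat) : expr :=
  EAdd (EMul (ECst (-2)) (EMul (EX i) EIA))
       (EMul (ECst (-2)) (EMul (EAdd (EX i) (EMul (ECst (-1)) (EY i))) EIB)).

Fixpoint der (alpha : R) (i : nat) (e : expr) : expr :=
  match e with
  | ECst _ => ECst 0
  | EX j => ECst (if Nat.eqb j i then 1 else 0)
  | EY _ => ECst 0
  | EIA => EMul (ECst 2) (EMul (EX i) (EMul EIA EIA))
  | EIB => EMul (ECst (-2)) (EMul (EAdd (EX i) (EMul (ECst (-1)) (EY i))) (EMul EIB EIB))
  | EG => EMul (ECst alpha) (EMul EG (dlog i))
  | ELg => dlog i
  | EAdd e1 e2 => EAdd (der alpha i e1) (der alpha i e2)
  | EMul e1 e2 => EAdd (EMul (der alpha i e1) e2) (EMul e1 (der alpha i e2))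
  end.

Lemma derivable_pt_lim_eq (f : R -> R) (x l l' : R) :
  l = l' -> derivable_pt_lim f x l -> derivable_pt_lim f x l'.
Proof. now intros ->. Qed.

Lemma derivable_pt_lim_ext (f g : R -> R) (x l : R) :
  (forall t, f t = g t) -> derivable_pt_lim f x l -> derivable_pt_lim g x l.
Proof. intros H. replace g with f; [auto|]. now apply functional_extensionality. Qed.

Lemma derivable_pt_lim_quadratic (a b c x : R) :
  derivable_pt_lim (fun t => a + (b + c * t) ^ 2) x (2 * c * (b + c * x)).
Proof.
  apply (derivable_pt_lim_ext (fct_cte (a + b ^ 2) + (mult_real_fct (2 * b * c) id
           + mult_real_fct (c ^ 2) Rsqr))%F).
  { intros t. unfold plus_fct, mult_real_fct, fct_cte, id, Rsqr. ring. }
  apply (derivable_pt_lim_eq _ _ (0 + (2 * b * c * 1 + c ^ 2 * (2 * x)))); [ring|].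
  apply derivable_pt_lim_plus; [apply derivable_pt_lim_const|].
  apply derivable_pt_lim_plus; apply derivable_pt_lim_scal;
    [apply derivable_pt_lim_id|apply derivable_pt_lim_Rsqr].
Qed.

Lemma derivable_pt_lim_bdy_defect (n : nat) (x : pt) (i : nat) (t : R) : (i < n)%nat ->
  derivable_pt_lim (fun t => bdy_defect n (shift x i t)) t (-2 * shift x i t i).
Proof.
  intros Hi.
  apply (derivable_pt_lim_ext (opp_fct (fun t => (rsum n (fun j => x j ^ 2) - x i ^ 2 - 1)
                                            + (x i + 1 * t) ^ 2))).
  { intros u. unfold bdy_defect, opp_fct. rewrite (rsum_shift n (fun j v => v ^ 2)) by exact Hi. ring. }
  eapply derivable_pt_lim_eq; [|apply derivable_pt_lim_opp, derivable_pt_lim_quadratic].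
  unfold shift. rewrite Nat.eqb_refl. ring.
Qed.

Lemma derivable_pt_lim_dist2 (n : nat) (x y : pt) (i : nat) (t : R) : (i < n)%nat ->
  derivable_pt_lim (fun t => dist2 n (shift x i t) y) t (2 * (shift x i t i - y i)).
Proof.
  intros Hi.
  apply (derivable_pt_lim_ext (fun t => (rsum n (fun j => (x j - y j) ^ 2) - (x i - y i) ^ 2)
                                            + ((x i - y i) + 1 * t) ^ 2)).
  { intros u. unfold dist2. rewrite (rsum_shift n (fun j v => (v - y j) ^ 2)) by exact Hi. ring. }
  eapply derivable_pt_lim_eq; [|apply derivable_pt_lim_quadratic].
  unfold shift. rewrite Nat.eqb_refl. ring.
Qed.

Lemma derivable_pt_lim_inv_fct (f : R -> R) (x l : R) : f x <> 0 ->
  derivable_pt_lim f x l -> derivable_pt_lim (fun t => / f t) x (- l * (/ f x * / f x)).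
Proof.
  intros Hne Hf.
  apply (derivable_pt_lim_ext (fct_cte 1 / f)%F).
  { intros t. unfold div_fct, fct_cte. unfold Rdiv. ring. }
  eapply derivable_pt_lim_eq;
    [|apply derivable_pt_lim_div; [apply derivable_pt_lim_const|exact Hf|exact Hne]].
  unfold fct_cte, Rsqr. field. exact Hne.
Qed.

(** Induction over the syntax. The derivative is taken at every [t], not only at 0, because the mean
    value arguments below run along whole segments. *)
Lemma derivable_pt_lim_ev (n : nat) (alpha : R) (e : expr) (x y : pt) (i : nat) (t : R) :
  (i < n)%nat -> 0 < bdy_defect n (shift x i t) -> 0 < dist2 n (shift x i t) y ->
  derivable_pt_lim (fun t => ev n alpha e (shift x i t) y) t
    (ev n alpha (der alpha i e) (shift x i t) y).
Proof.
  intros Hi HA HB.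
  assert (DA := derivable_pt_lim_inv_fct (fun t => bdy_defect n (shift x i t)) _ _ (Rgt_not_eq _ _ HA)
                  (derivable_pt_lim_bdy_defect n x i t Hi)). cbv beta in DA.
  assert (DB := derivable_pt_lim_inv_fct (fun t => dist2 n (shift x i t) y) _ _ (Rgt_not_eq _ _ HB)
                  (derivable_pt_lim_dist2 n x y i t Hi)). cbv beta in DB.
  assert (DL : derivable_pt_lim (fun t => ln (poisson n (shift x i t) y)) t
                 (ev n alpha (dlog i) (shift x i t) y)).
  { assert (Hq : 0 < poisson n (shift x i t) y) by now apply Rdiv_lt_0_compat.
    eapply derivable_pt_lim_eq; cycle 1.
    - apply (derivable_pt_lim_comp (fun t => poisson n (shift x i t) y) ln).
      + unfold poisson, Rdiv. apply (derivable_pt_lim_mult (fun t => bdy_defect n (shift x i t))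
          (fun t => / dist2 n (shift x i t) y)).
        * now apply derivable_pt_lim_bdy_defect.
        * exact DB.
      + apply derivable_pt_lim_ln. exact Hq.
    - simpl. unfold poisson. field. split; lra. }
  induction e as [c|j|j| | | | |e1 IH1 e2 IH2|e1 IH1 e2 IH2]; simpl.
  - apply derivable_pt_lim_const.
  - unfold shift. destruct (Nat.eqb j i).
    + apply (derivable_pt_lim_ext (fct_cte (x j) + id)%F).
      { intros u. unfold plus_fct, fct_cte, id. ring. }
      apply (derivable_pt_lim_eq _ _ (0 + 1)); [ring|].
      apply derivable_pt_lim_plus; [apply derivable_pt_lim_const|apply derivable_pt_lim_id].
    + apply derivable_pt_lim_const.
  - apply derivable_pt_lim_const.
  - eapply derivable_pt_lim_eq; [|exact DA]. ring.
  - eapply derivable_pt_lim_eq; [|exact DB]. ring.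
  - eapply derivable_pt_lim_eq; cycle 1.
    + apply (derivable_pt_lim_comp (mult_real_fct alpha (fun t => ln (poisson n (shift x i t) y))) exp).
      * apply derivable_pt_lim_scal. exact DL.
      * apply derivable_pt_lim_exp.
    + unfold mult_real_fct. simpl. ring.
  - exact DL.
  - now apply derivable_pt_lim_plus.
  - eapply derivable_pt_lim_eq; [|apply derivable_pt_lim_mult; [exact IH1|exact IH2]].
    reflexivity.
Qed.

Lemma bdy_defect_vnorm (n : nat) (x : pt) : bdy_defect n x = 1 - vnorm n x ^ 2.
Proof. unfold bdy_defect. now rewrite vnorm_sq. Qed.

Lemma dist2_dist (n : nat) (x y : pt) : dist2 n x y = dist n x y ^ 2.
Proof. unfold dist. now rewrite vnorm_sq. Qed.

Lemma dist_sphere_bounds (n : nat) (x y : pt) : unit_sphere n y ->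
  1 - vnorm n x <= dist n x y <= 1 + vnorm n x.
Proof.
  intros [_ Hy]. pose proof (vnorm_le_dist n y x) as H1. rewrite dist_sym in H1.
  pose proof (dist_triangle n x origin y) as H2.
  rewrite (dist_sym n origin y), !dist_origin in H2. lra.
Qed.

Lemma dist2_pos (n : nat) (x y : pt) : vnorm n x < 1 -> unit_sphere n y -> 0 < dist2 n x y.
Proof.
  intros Hx Hy. rewrite dist2_dist. apply pow_lt. pose proof (dist_sphere_bounds n x y Hy). lra.
Qed.

Lemma bdy_defect_pos (n : nat) (x : pt) : vnorm n x < 1 -> 0 < bdy_defect n x.
Proof. intros Hx. rewrite bdy_defect_vnorm. pose proof (vnorm_nonneg n x). nra. Qed.

Lemma ln_le_self (z : R) : 0 < z -> ln z <= z.
Proof.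
  intros Hz. pose proof (exp_ineq1_le (ln z)) as H. rewrite exp_ln in H by exact Hz. lra.
Qed.

(** The inequality ln w <= w is used for w = z and for w = 1/z. *)
Lemma Rabs_ln_le (z m M : R) : 0 < m -> m <= z -> z <= M -> Rabs (ln z) <= M + / m.
Proof.
  intros Hm H1 H2. pose proof (Rinv_0_lt_compat m Hm).
  pose proof (ln_le_self z ltac:(lra)).
  pose proof (ln_le_self (/ z) (Rinv_0_lt_compat z ltac:(lra))) as H3.
  rewrite ln_Rinv in H3 by lra.
  pose proof (Rinv_le_contravar m z Hm H1). apply Rabs_le. lra.
Qed.

Lemma exp_le_mono (a b : R) : a <= b -> exp a <= exp b.
Proof. intros [H| ->]; [left; now apply exp_increasing|lra]. Qed.

(** On |x| <= [rho] one has 1 - rho^2 <= A <= 1 and (1 - rho)^2 <= B <= 4, which bounds every leaf;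
    sums and products follow. The bound is uniform in the boundary point, as needed to pass
    estimates through [J]. *)
Lemma ev_bounded (n : nat) (alpha : R) (e : expr) (rho : R) : 0 <= alpha -> rho < 1 ->
  exists C, 0 <= C /\ forall x y, inRn n x -> vnorm n x <= rho -> unit_sphere n y ->
    Rabs (ev n alpha e x y) <= C.
Proof.
  intros Ha Hr.
  destruct (Rle_lt_dec 0 rho) as [Hr0|Hr0].
  2:{ exists 0. split; [lra|]. intros x y _ Hx _. pose proof (vnorm_nonneg n x). lra. }
  pose (a := 1 - rho ^ 2). assert (Ha0 : 0 < a) by (unfold a; nra).
  pose (b := (1 - rho) ^ 2). assert (Hb0 : 0 < b) by (unfold b; apply pow_lt; lra).
  assert (HA : forall x, vnorm n x <= rho -> a <= bdy_defect n x <= 1).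
  { intros x Hx. rewrite bdy_defect_vnorm. pose proof (vnorm_nonneg n x). unfold a. nra. }
  assert (HB : forall x y, vnorm n x <= rho -> unit_sphere n y -> b <= dist2 n x y <= 4).
  { intros x y Hx Hy. rewrite dist2_dist. pose proof (dist_sphere_bounds n x y Hy).
    pose proof (vnorm_nonneg n x). unfold b. split; nra. }
  assert (HQ : forall x y, vnorm n x <= rho -> unit_sphere n y ->
            Rabs (ln (poisson n x y)) <= / b + / (a / 4)).
  { intros x y Hx Hy. specialize (HA x Hx). specialize (HB x y Hx Hy).
    apply Rabs_ln_le; [lra| |]; unfold poisson, Rdiv.
    - apply Rmult_le_compat; try lra. apply Rinv_le_contravar; lra.
    - rewrite <- (Rmult_1_l (/ b)). apply Rmult_le_compat; try lra.
      + left. apply Rinv_0_lt_compat. lra.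
      + apply Rinv_le_contravar; lra. }
  assert (Hc : forall z i, inRn n z -> vnorm n z <= 1 -> Rabs (z i) <= 1).
  { intros z i Hz Hz1. destruct (Nat.lt_ge_cases i n) as [Hi|Hi].
    - pose proof (coord_le_vnorm n z i Hi). lra.
    - rewrite (Hz i Hi), Rabs_R0. lra. }
  induction e as [c|j|j| | | | |e1 IH1 e2 IH2|e1 IH1 e2 IH2]; simpl.
  - exists (Rabs c). split; [apply Rabs_pos|]. intros; lra.
  - exists 1. split; [lra|]. intros x y Hx Hxr _. apply Hc; [auto|lra].
  - exists 1. split; [lra|]. intros x y _ _ [Hy Hy1]. apply Hc; [auto|lra].
  - exists (/ a). split; [left; now apply Rinv_0_lt_compat|]. intros x y _ Hx _.
    specialize (HA x Hx). rewrite Rabs_pos_eq by (left; apply Rinv_0_lt_compat; lra).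
    apply Rinv_le_contravar; lra.
  - exists (/ b). split; [left; now apply Rinv_0_lt_compat|]. intros x y _ Hx Hy.
    specialize (HB x y Hx Hy). rewrite Rabs_pos_eq by (left; apply Rinv_0_lt_compat; lra).
    apply Rinv_le_contravar; lra.
  - exists (exp (alpha * (/ b + / (a / 4)))). split; [left; apply exp_pos|]. intros x y _ Hx Hy.
    rewrite Rabs_pos_eq by (left; apply exp_pos). apply exp_le_mono.
    apply Rmult_le_compat_l; [exact Ha|]. specialize (HQ x y Hx Hy).
    pose proof (Rle_abs (ln (poisson n x y))). lra.
  - exists (/ b + / (a / 4)). split; [|auto].
    pose proof (Rinv_0_lt_compat b Hb0). pose proof (Rinv_0_lt_compat (a / 4) ltac:(lra)). lra.
  - destruct IH1 as [C1 [H1 HC1]], IH2 as [C2 [H2 HC2]]. exists (C1 + C2). split; [lra|].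
    intros x y Hx Hxr Hy. eapply Rle_trans; [apply Rabs_triang|].
    apply Rplus_le_compat; auto.
  - destruct IH1 as [C1 [H1 HC1]], IH2 as [C2 [H2 HC2]]. exists (C1 * C2). split; [now apply Rmult_le_pos|].
    intros x y Hx Hxr Hy. rewrite Rabs_mult. apply Rmult_le_compat; auto; apply Rabs_pos.
Qed.

Lemma Rabs_between (c t : R) : Rmin 0 t <= c <= Rmax 0 t -> Rabs c <= Rabs t.
Proof.
  unfold Rmin, Rmax, Rabs. destruct (Rle_dec 0 t), (Rcase_abs c), (Rcase_abs t); lra.
Qed.

(** The mean value theorem is applied to f(u) - f'(0) u and then to f', whence the constant [C]
    instead of C/2. *)
Lemma taylor_order1 (f f' f'' : R -> R) (t C : R) :
  (forall c, Rabs c <= Rabs t -> derivable_pt_lim f c (f' c)) ->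
  (forall c, Rabs c <= Rabs t -> derivable_pt_lim f' c (f'' c)) ->
  (forall c, Rabs c <= Rabs t -> Rabs (f'' c) <= C) ->
  Rabs (f t - f 0 - t * f' 0) <= C * t ^ 2.
Proof.
  intros H1 H2 HC.
  destruct (MVT_abs (fun u => f u - f' 0 * u) (fun u => f' u - f' 0) 0 t) as [c [Hc Hct]].
  { intros c Hc. apply Rabs_between in Hc.
    apply (derivable_pt_lim_minus f (fun u => f' 0 * u)); [now apply H1|].
    eapply derivable_pt_lim_eq; [|apply (derivable_pt_lim_scal id), derivable_pt_lim_id]. ring. }
  apply Rabs_between in Hct.
  destruct (MVT_abs f' f'' 0 c) as [b [Hb Hbc]].
  { intros b Hb. apply Rabs_between in Hb. apply H2. lra. }
  apply Rabs_between in Hbc.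
  replace (f t - f 0 - t * f' 0) with (f t - f' 0 * t - (f 0 - f' 0 * 0)) by ring.
  rewrite Hc, Hb, !Rminus_0_r.
  assert (HC0 : Rabs (f'' b) <= C) by (apply HC; lra).
  pose proof (Rabs_pos (f'' b)). pose proof (Rabs_pos c). pose proof (Rabs_pos t).
  replace (t ^ 2) with (Rabs t * Rabs t) by (rewrite <- pow2_abs; ring).
  rewrite <- Rmult_assoc. apply Rmult_le_compat_r; [lra|].
  apply Rmult_le_compat; lra.
Qed.

Lemma vnorm_shift_le (n : nat) (x : pt) (i : nat) (c : R) : (i < n)%nat ->
  vnorm n (shift x i c) <= vnorm n x + Rabs c.
Proof.
  intros Hi. pose proof (vnorm_le_dist n (shift x i c) x). rewrite dist_shift in H; auto.
Qed.

Section MeanOfKernel.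

Variables (n : nat) (alpha : R) (L : pt -> Prop) (J : (pt -> R) -> R).
Hypotheses (Ha : 0 <= alpha) (HL : forall y, L y -> unit_sphere n y) (HJ : is_mean L J).

Lemma bdd_on_ev (e : expr) (x : pt) : unit_ball n x -> bdd_on L (ev n alpha e x).
Proof.
  intros [Hx Hx1]. destruct (ev_bounded n alpha e (vnorm n x) Ha Hx1) as [C [_ HC]].
  exists C. intros y Hy. apply HC; auto. lra.
Qed.

Lemma mean_one_nonneg : 0 <= J (fun _ => 1).
Proof. apply HJ; [apply bdd_on_const|]. intros; lra. Qed.

(** By linearity the remainder of [J] is [J] of the pointwise Taylor remainder, which is at most C
    t^2 for all boundary points at once; positivity then bounds it by C t^2 J(1). *)
Lemma derivable_pt_lim_mean_ev (e : expr) (x : pt) (i : nat) : unit_ball n x -> (i < n)%nat ->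
  derivable_pt_lim (fun t => J (ev n alpha e (shift x i t))) 0 (J (ev n alpha (der alpha i e) x)).
Proof.
  intros Hx Hi. destruct (Hx) as [Hx0 Hx1].
  (* Moving x by at most [tau] keeps it in the ball of radius [rho], halfway to the sphere. *)
  pose (rho := (1 + vnorm n x) / 2). pose (tau := (1 - vnorm n x) / 2).
  destruct (ev_bounded n alpha (der alpha i (der alpha i e)) rho Ha) as [C [HC0 HC]];
    [unfold rho; lra|].
  assert (Hball : forall c, Rabs c <= tau -> inRn n (shift x i c) /\ vnorm n (shift x i c) <= rho).
  { intros c Hc. split; [now apply shift_inRn|].
    pose proof (vnorm_shift_le n x i c Hi). unfold rho, tau in *. lra. }
  assert (Hub : forall c, Rabs c <= tau -> unit_ball n (shift x i c)).
  { intros c Hc. destruct (Hball c Hc). split; [auto|]. unfold rho in *; lra. }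
  pose (T := J (fun _ => 1)).
  assert (HT : 0 <= T) by apply mean_one_nonneg.
  assert (Hrem : forall t, Rabs t <= tau ->
    Rabs (J (ev n alpha e (shift x i t)) - J (ev n alpha e x)
          - t * J (ev n alpha (der alpha i e) x)) <= C * t ^ 2 * T).
  { intros t Ht.
    replace (J (ev n alpha e (shift x i t)) - J (ev n alpha e x)
          - t * J (ev n alpha (der alpha i e) x)) with
      (J (fun y => (ev n alpha e (shift x i t) y + -1 * ev n alpha e x y)
          + - t * ev n alpha (der alpha i e) x y)).
    2:{ destruct HJ as [Hl _]. rewrite Hl, Hl; auto using bdd_on_ev, bdd_on_lin. ring. }
    apply (mean_abs_le L); [exact HJ|]. intros y Hy.
    replace (_ + _) with (ev n alpha e (shift x i t) y - ev n alpha e (shift x i 0) y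
        - t * ev n alpha (der alpha i e) (shift x i 0) y) by (rewrite shift_0; ring).
    apply (taylor_order1 (fun t => ev n alpha e (shift x i t) y)
      (fun t => ev n alpha (der alpha i e) (shift x i t) y)
      (fun t => ev n alpha (der alpha i (der alpha i e)) (shift x i t) y)).
    - intros c Hc. destruct (Hub c ltac:(lra)). apply derivable_pt_lim_ev; auto.
      + now apply bdy_defect_pos.
      + apply dist2_pos; auto.
    - intros c Hc. destruct (Hub c ltac:(lra)). apply derivable_pt_lim_ev; auto.
      + now apply bdy_defect_pos.
      + apply dist2_pos; auto.
    - intros c Hc. destruct (Hball c ltac:(lra)). apply HC; auto. }
  intros eps Heps.
  (* The summand 1 keeps the denominator positive when C T = 0. *)
  assert (Hd : 0 < Rmin tau (eps / (C * T + 1))).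
  { apply Rmin_pos; [unfold tau; lra|]. apply Rdiv_lt_0_compat; [lra|]. nra. }
  exists (mkposreal _ Hd). intros h Hh Hhd. simpl in Hhd.
  pose proof (Rmin_l tau (eps / (C * T + 1))). pose proof (Rmin_r tau (eps / (C * T + 1))).
  specialize (Hrem h ltac:(lra)). rewrite Rplus_0_l, shift_0.
  assert (Hh0 : 0 < Rabs h) by now apply Rabs_pos_lt.
  replace ((J (ev n alpha e (shift x i h)) - J (ev n alpha e x)) / h
    - J (ev n alpha (der alpha i e) x)) with
    ((J (ev n alpha e (shift x i h)) - J (ev n alpha e x)
      - h * J (ev n alpha (der alpha i e) x)) * / h) by (field; exact Hh).
  rewrite Rabs_mult, Rabs_inv.
  apply (Rmult_lt_reg_r (Rabs h)); [exact Hh0|]. rewrite Rmult_assoc, Rinv_l, Rmult_1_r by lra.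
  eapply Rle_lt_trans; [exact Hrem|].
  replace (h ^ 2) with (Rabs h * Rabs h) by (rewrite <- pow2_abs; ring).
  replace (C * (Rabs h * Rabs h) * T) with ((C * T * Rabs h) * Rabs h) by ring.
  apply Rmult_lt_compat_r; [exact Hh0|].
  assert (Hlt : Rabs h * (C * T + 1) < eps).
  { apply (Rmult_lt_reg_r (/ (C * T + 1))); [apply Rinv_0_lt_compat; nra|].
    rewrite Rmult_assoc, Rinv_r by nra. unfold Rdiv in *. lra. }
  nra.
Qed.

(** The k-th corner of the path from [x] to [z] that changes one coordinate at a time. *)
Definition patch (x z : pt) (k : nat) : pt := fun j => if Nat.ltb j k then z j else x j.

(** Bounds are at hand for partial derivatives only, so the mean value theorem is used on each edge
    of an axis-parallel path. This gives a local Lipschitz estimate with constant n C J(1). *)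
Lemma continuous_on_mean_ev (e : expr) :
  continuous_on n (unit_ball n) (fun x => J (ev n alpha e x)).
Proof.
  intros x [Hx0 Hx1] eps Heps.
  pose (rho := (1 + vnorm n x) / 2). pose (tau := (1 - vnorm n x) / 2).
  assert (HCs : exists C, 0 <= C /\ forall i, (i < n)%nat -> forall z y,
     inRn n z -> vnorm n z <= rho -> unit_sphere n y -> Rabs (ev n alpha (der alpha i e) z y) <= C).
  { enough (H : forall m, exists C, 0 <= C /\ forall i, (i < m)%nat -> forall z y,
     inRn n z -> vnorm n z <= rho -> unit_sphere n y -> Rabs (ev n alpha (der alpha i e) z y) <= C)
     by apply H.
    induction m as [|m [C [HC0 HC]]].
    - exists 0. split; [lra|]. intros; lia.
    - destruct (ev_bounded n alpha (der alpha m e) rho Ha) as [C' [HC0' HC']]; [unfold rho; lra|].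
      exists (C + C'). split; [lra|]. intros i Hi z y Hz Hzr Hy.
      destruct (Nat.eq_dec i m) as [->|Hne].
      + specialize (HC' z y Hz Hzr Hy). lra.
      + specialize (HC i ltac:(lia) z y Hz Hzr Hy). lra. }
  destruct HCs as [C [HC0 HC]].
  pose (T := J (fun _ => 1)).
  assert (HT : 0 <= T) by apply mean_one_nonneg.
  assert (Hn : 0 <= INR n) by apply pos_INR.
  pose (M := INR n * C * T + 1).
  assert (HM : 0 < M) by (unfold M; pose proof (Rmult_le_pos _ _ (Rmult_le_pos _ _ Hn HC0) HT); lra).
  exists (Rmin tau (eps / M)).
  split; [apply Rmin_pos; [unfold tau; lra|now apply Rdiv_lt_0_compat]|].
  intros z [Hz0 Hz1] Hzx.
  pose proof (Rmin_l tau (eps / M)). pose proof (Rmin_r tau (eps / M)).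
  pose (d := dist n z x). fold d in Hzx.
  assert (Hzi : forall i, (i < n)%nat -> Rabs (z i - x i) <= d).
  { intros i Hi. apply (coord_le_vnorm n (vsub z x) i Hi). }
  (* Coordinate by coordinate, a point of the path is at most as far from [x] as [z] is; the whole
     path therefore stays in the ball of radius [rho]. *)
  assert (Hpatch : forall k t, Rabs t <= Rabs (z k - x k) -> (k < n)%nat ->
     inRn n (shift (patch x z k) k t) /\ vnorm n (shift (patch x z k) k t) <= rho).
  { intros k t Ht Hk. split.
    - apply shift_inRn; [exact Hk|]. intros j Hj. unfold patch. destruct (Nat.ltb j k); auto.
    - apply Rle_trans with (vnorm n x + d); [|unfold rho, tau in *; lra].
      eapply Rle_trans; [apply (vnorm_le_dist n _ x)|]. apply Rplus_le_compat_l.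
      apply vnorm_le_of_sq; [apply dist_nonneg|]. unfold d, dist. rewrite vnorm_sq.
      apply rsum_le. intros j Hj. unfold vsub, shift, patch.
      destruct (Nat.eqb_spec j k) as [->|Hne].
      + rewrite Nat.ltb_irrefl. replace (x k + t - x k) with t by ring.
        rewrite <- (pow2_abs t), <- (pow2_abs (z k - x k)). apply pow_incr.
        split; [apply Rabs_pos|exact Ht].
      + destruct (Nat.ltb j k); [lra|].
        replace (x j - x j) with 0 by ring. pose proof (pow2_ge_0 (z j - x j)). lra. }
  assert (Hy : forall y, L y -> forall k, (k <= n)%nat ->
     Rabs (ev n alpha e (patch x z k) y - ev n alpha e x y) <= INR k * (C * d)).
  { intros y Hy. induction k as [|k IH]; intros Hk.
    - replace (patch x z 0) with x by (apply functional_extensionality; intros j; reflexivity).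
      rewrite Rminus_diag, Rabs_R0. simpl. lra.
    - specialize (IH ltac:(lia)). rewrite S_INR.
      assert (Hs : patch x z (S k) = shift (patch x z k) k (z k - x k)).
      { apply functional_extensionality. intros j. unfold patch, shift.
        destruct (Nat.eqb_spec j k) as [->|Hne].
        - rewrite Nat.ltb_irrefl. destruct (Nat.ltb_spec k (S k)); [ring|lia].
        - destruct (Nat.ltb_spec j (S k)), (Nat.ltb_spec j k); try lia; reflexivity. }
      destruct (MVT_abs (fun t => ev n alpha e (shift (patch x z k) k t) y)
        (fun t => ev n alpha (der alpha k e) (shift (patch x z k) k t) y) 0 (z k - x k))
        as [c [Hc Hct]].
      { intros c Hc. apply Rabs_between in Hc. destruct (Hpatch k c Hc ltac:(lia)).
        assert (vnorm n (shift (patch x z k) k c) < 1) by (unfold rho in *; lra).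
        apply derivable_pt_lim_ev; [lia|now apply bdy_defect_pos|apply dist2_pos; auto]. }
      apply Rabs_between in Hct. destruct (Hpatch k c Hct ltac:(lia)) as [P1 P2].
      rewrite shift_0, <- Hs, Rminus_0_r in Hc.
      specialize (HC k ltac:(lia) _ _ P1 P2 (HL y Hy)). specialize (Hzi k ltac:(lia)).
      replace (ev n alpha e (patch x z (S k)) y - ev n alpha e x y) with
        ((ev n alpha e (patch x z (S k)) y - ev n alpha e (patch x z k) y)
         + (ev n alpha e (patch x z k) y - ev n alpha e x y)) by ring.
      eapply Rle_trans; [apply Rabs_triang|]. rewrite Hc.
      assert (Rabs (ev n alpha (der alpha k e) (shift (patch x z k) k c) y) * Rabs (z k - x k)
        <= C * d) by (apply Rmult_le_compat; auto; apply Rabs_pos).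
      lra. }
  assert (Hzz : patch x z n = z).
  { apply functional_extensionality. intros j. unfold patch.
    destruct (Nat.ltb_spec j n); [reflexivity|]. rewrite Hx0, Hz0; auto. }
  replace (J (ev n alpha e z) - J (ev n alpha e x)) with
    (J (fun y => ev n alpha e z y + -1 * ev n alpha e x y)).
  2:{ destruct HJ as [Hl _]. rewrite Hl by (apply bdd_on_ev; split; auto). ring. }
  eapply Rle_lt_trans; [apply (mean_abs_le L J _ (INR n * (C * d)) HJ)|].
  - intros y Ly. specialize (Hy y Ly n (le_n n)). rewrite Hzz in Hy.
    replace (ev n alpha e z y + -1 * ev n alpha e x y) with (ev n alpha e z y - ev n alpha e x y) by ring.
    exact Hy.
  - fold T. assert (0 <= d) by apply dist_nonneg.
    assert (Hlt : d * M < eps).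
    { apply (Rmult_lt_reg_r (/ M)); [now apply Rinv_0_lt_compat|].
      rewrite Rmult_assoc, Rinv_r by lra. unfold Rdiv in *. lra. }
    unfold M in Hlt. lra.
Qed.

(** The family of partials is [J] of the iterated formal derivatives; [fold_right] applies the head
    of the multi-index last, as [is_partials] demands. *)
Lemma is_partials_mean_ev (e : expr) :
  is_partials n (unit_ball n) (fun x => J (ev n alpha e x))
    (fun a x => J (ev n alpha (fold_right (der alpha) e a) x)).
Proof.
  split; [reflexivity|split].
  - intros a i x Hx Hi. simpl. now apply derivable_pt_lim_mean_ev.
  - intros a. apply continuous_on_mean_ev.
Qed.

End MeanOfKernel.

(** * The kernel P^alpha ln P *)

Definition log_poisson : expr := EMul EG ELg.

Lemma ev_der_log_poisson (n : nat) (alpha : R) (i : nat) (x y : pt) :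
  ev n alpha (der alpha i log_poisson) x y =
  ev n alpha EG x y * ev n alpha (dlog i) x y * (alpha * ev n alpha ELg x y + 1).
Proof. simpl. ring. Qed.

Lemma ev_der2_log_poisson (n : nat) (alpha : R) (i : nat) (x y : pt) :
  ev n alpha (der alpha i (der alpha i log_poisson)) x y =
  ev n alpha EG x y *
    (ev n alpha (dlog i) x y ^ 2 * (alpha ^ 2 * ev n alpha ELg x y + 2 * alpha)
     + ev n alpha (der alpha i (dlog i)) x y * (alpha * ev n alpha ELg x y + 1)).
Proof. cbn -[exp ln]. ring. Qed.

(** Because |xi| = 1, all sums over coordinates reduce to A and B: |x|^2 = 1 - A, x . (x - xi) = (B
    - A)/2 and |x - xi|^2 = B. With n = 2 alpha + 1 what remains is a rational identity, in which
    the terms without ln P cancel. *)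
Lemma log_poisson_eigen (n : nat) (x y : pt) : unit_ball n x -> unit_sphere n y ->
  let alpha := (INR n - 1) / 2 in
  bdy_defect n x ^ 2 / 4 * rsum n (fun i => ev n alpha (der alpha i (der alpha i log_poisson)) x y)
  + (INR n - 2) * (bdy_defect n x / 2) *
    rsum n (fun i => x i * ev n alpha (der alpha i log_poisson) x y)
  = - alpha ^ 2 * ev n alpha log_poisson x y.
Proof.
  intros [_ Hx] Hy alpha.
  pose proof (bdy_defect_pos n x Hx) as HA. pose proof (dist2_pos n x y Hx Hy) as HB.
  assert (Hy1 : rsum n (fun i => y i ^ 2) = 1).
  { rewrite <- vnorm_sq. destruct Hy as [_ ->]. ring. }
  set (S1 := rsum n (fun i => x i ^ 2)).
  set (S2 := rsum n (fun i => x i * (x i - y i))).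
  assert (E1 : S1 = 1 - bdy_defect n x) by (unfold bdy_defect; fold S1; ring).
  assert (E2 : S2 = (dist2 n x y - bdy_defect n x) / 2).
  { unfold dist2.
    rewrite (rsum_ext n (fun i => (x i - y i) ^ 2)
       (fun i => (y i ^ 2 + 2 * (x i * (x i - y i))) + -1 * x i ^ 2)) by (intros; ring).
    rewrite !rsum_plus, !rsum_scal. fold S1 S2. rewrite Hy1, E1. field. }
  assert (E3 : rsum n (fun i => (x i - y i) ^ 2) = dist2 n x y) by reflexivity.
  set (g := ev n alpha EG x y). set (l := ev n alpha ELg x y).
  set (A := bdy_defect n x) in *. set (B := dist2 n x y) in *.
  (* The second derivative is sorted by x_i^2, x_i (x_i - xi_i), (x_i - xi_i)^2 and a term
     independent of i. *)
  rewrite (rsum_ext n (fun i => ev n alpha (der alpha i (der alpha i log_poisson)) x y)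
    (fun i => (g * ((alpha ^ 2 * l + 2 * alpha) * 4 / A ^ 2 - (alpha * l + 1) * 4 / A ^ 2)) * x i ^ 2
      + ((g * (alpha ^ 2 * l + 2 * alpha) * 8 / (A * B)) * (x i * (x i - y i))
      + ((g * ((alpha ^ 2 * l + 2 * alpha) * 4 / B ^ 2 + (alpha * l + 1) * 4 / B ^ 2)) * (x i - y i) ^ 2
      + g * (alpha * l + 1) * (-2 / A - 2 / B))))).
  2:{ intros i _. rewrite ev_der2_log_poisson. fold g l. cbn -[exp ln pow]. fold A B.
      rewrite Nat.eqb_refl. field. lra. }
  rewrite (rsum_ext n (fun i => x i * ev n alpha (der alpha i log_poisson) x y)
    (fun i => (g * (alpha * l + 1) * (-2 / A)) * x i ^ 2
       + (g * (alpha * l + 1) * (-2 / B)) * (x i * (x i - y i)))).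
  2:{ intros i _. rewrite ev_der_log_poisson. fold g l. cbn -[exp ln pow]. fold A B. field. lra. }
  rewrite !rsum_plus, !rsum_scal, !rsum_const. fold S1 S2. rewrite E1, E2, E3.
  change (ev n alpha log_poisson x y) with (g * l).
  replace (INR n) with (2 * alpha + 1) by (unfold alpha; field).
  field. lra.
Qed.

Lemma hyp_laplacian_mean (n : nat) (L : pt -> Prop) (J : (pt -> R) -> R) (x : pt) :
  (1 <= n)%nat -> (forall y, L y -> unit_sphere n y) -> is_mean L J -> unit_ball n x ->
  let alpha := (INR n - 1) / 2 in
  - hyp_laplacian n (fun a x => J (ev n alpha (fold_right (der alpha) log_poisson a) x)) x
  = (INR n - 1) ^ 2 / 4 * J (ev n alpha log_poisson x).
Proof.
  intros Hn HL HJ Hx alpha.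
  assert (Ha : 0 <= alpha) by (apply le_INR in Hn; simpl in Hn; unfold alpha; lra).
  assert (Hb : forall e, bdd_on L (ev n alpha e x)) by (intros e; now apply bdd_on_ev).
  unfold hyp_laplacian. cbv beta iota delta [fold_right]. rewrite <- bdy_defect_vnorm.
  rewrite <- (mean_rsum L J n
    (fun i => ev n alpha (der alpha i (der alpha i log_poisson)) x)) by auto.
  rewrite (rsum_ext n (fun i => x i * _)
     (fun i => J (fun y => x i * ev n alpha (der alpha i log_poisson) x y)))
    by (intros i _; symmetry; now apply (mean_scal L)).
  rewrite <- (mean_rsum L J n (fun i y => x i * ev n alpha (der alpha i log_poisson) x y))
    by (auto; intros; apply bdd_on_scal; auto).
  set (f := fun y => rsum n (fun i => ev n alpha (der alpha i (der alpha i log_poisson)) x y)).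
  set (h := fun y => rsum n (fun i => x i * ev n alpha (der alpha i log_poisson) x y)).
  assert (Hf : bdd_on L f) by (apply bdd_on_rsum; auto).
  assert (Hh : bdd_on L h) by (apply bdd_on_rsum; intros; apply bdd_on_scal; auto).
  set (c1 := bdy_defect n x ^ 2 / 4). set (c2 := (INR n - 2) * (bdy_defect n x / 2)).
  rewrite <- (mean_scal L J f c1 HJ Hf).
  assert (E : J (fun y => c1 * f y + c2 * h y) = J (fun y => c1 * f y) + c2 * J h).
  { apply HJ; [now apply bdd_on_scal|exact Hh]. }
  rewrite <- E.
  rewrite (mean_ext L J _ (fun y => - alpha ^ 2 * ev n alpha log_poisson x y) HJ).
  - rewrite (mean_scal L) by auto. unfold alpha. field.
  - apply bdd_on_lin; [now apply bdd_on_scal|exact Hh].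
  - intros y Hy. unfold c1, c2, f, h, alpha. apply log_poisson_eigen; auto.
Qed.

(** * Truncated power kernels and the dyadic bound *)

Definition far (n : nat) (beta rho : R) (x y : pt) : R :=
  if Rle_dec rho (dist n x y) then Rpower (dist n x y) (- beta) else 0.

Lemma Rpower_neg_antitone (a b beta : R) : 0 <= beta -> 0 < a -> a <= b ->
  Rpower b (- beta) <= Rpower a (- beta).
Proof.
  intros Hb Ha Hab. rewrite !Rpower_Ropp. apply Rinv_le_contravar; [apply Rpower_pos|].
  apply Rle_Rpower_l; lra.
Qed.

Lemma far_bounds (n : nat) (beta rho : R) (x y : pt) : 0 <= beta -> 0 < rho ->
  0 <= far n beta rho x y <= Rpower rho (- beta).
Proof.
  intros Hb Hr. unfold far. destruct (Rle_dec rho (dist n x y)) as [h|h].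
  - split; [left; apply Rpower_pos|]. now apply Rpower_neg_antitone.
  - split; [lra|left; apply Rpower_pos].
Qed.

Lemma bdd_on_far (n : nat) (L : pt -> Prop) (beta rho : R) (x : pt) : 0 <= beta -> 0 < rho ->
  bdd_on L (far n beta rho x).
Proof.
  intros Hb Hr. exists (Rpower rho (- beta)). intros y _.
  pose proof (far_bounds n beta rho x y Hb Hr). apply Rabs_le. lra.
Qed.

(** The shell containing [y] already contributes enough. Full balls stand in for shells since the
    mean is controlled on balls; the overlap costs only a constant. *)
Lemma far_le_dyadic (n : nat) (beta rho : R) (x y : pt) (N : nat) : 0 <= beta -> 0 < rho ->
  dist n x y < 2 ^ N * rho ->
  far n beta rho x y <= rsum N (fun k => Rpower (2 ^ k * rho) (- beta) *
                                  ind (fun y => dist n x y <= 2 ^ S k * rho) y).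
Proof.
  intros Hb Hr. induction N as [|N IH]; intros HN.
  - unfold far. simpl in *. destruct (Rle_dec rho (dist n x y)); lra.
  - assert (Hpow : 0 < 2 ^ N * rho) by (apply Rmult_lt_0_compat; [apply pow_lt; lra|lra]).
    simpl rsum. destruct (Rlt_le_dec (dist n x y) (2 ^ N * rho)) as [h|h].
    + specialize (IH h).
      pose proof (Rmult_le_pos _ _ (Rlt_le _ _ (Rpower_pos (2 ^ N * rho) (- beta)))
                    (proj1 (ind_bounds (fun y => dist n x y <= 2 ^ S N * rho) y))).
      simpl in *. lra.
    + rewrite (ind_true (fun y => dist n x y <= 2 * 2 ^ N * rho)) by (simpl in HN; lra).
      assert (0 <= rsum N (fun k => Rpower (2 ^ k * rho) (- beta) *
                                  ind (fun y => dist n x y <= 2 ^ S k * rho) y)).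
      { apply rsum_nonneg. intros k _. apply Rmult_le_pos; [left; apply Rpower_pos|apply ind_bounds]. }
      assert (far n beta rho x y <= Rpower (2 ^ N * rho) (- beta)).
      { unfold far. destruct (Rle_dec rho (dist n x y)); [|left; apply Rpower_pos].
        apply Rpower_neg_antitone; lra. }
      simpl in *. lra.
Qed.

Lemma Rpower_pow2_mult (k : nat) (rho g : R) : 0 < rho ->
  Rpower (2 ^ k * rho) g = Rpower 2 g ^ k * Rpower rho g.
Proof.
  intros Hr. rewrite <- Rpower_mult_distr by (auto; apply pow_lt; lra). f_equal.
  rewrite <- !Rpower_pow by (lra || apply Rpower_pos).
  rewrite !Rpower_mult. f_equal. ring.
Qed.

Lemma geometric_rsum_le (q : R) (N : nat) : 0 < q -> q < 1 -> rsum N (fun k => q ^ k) <= / (1 - q).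
Proof.
  intros H0 H1. assert (E : rsum N (fun k => q ^ k) = (1 - q ^ N) / (1 - q)).
  { induction N as [|N IH]; simpl; [field; lra|]. rewrite IH. field. lra. }
  rewrite E. unfold Rdiv. rewrite <- (Rmult_1_l (/ (1 - q))) at 2.
  apply Rmult_le_compat_r; [left; apply Rinv_0_lt_compat; lra|].
  pose proof (pow_lt q N H0). lra.
Qed.

(** The 6 is 3 * 2: outer radius twice the inner one, times the factor 3 lost when a ball is
    recentered on [L]. The inverse is the sum of a geometric series of ratio 2^(s - beta). *)
Definition far_const (K s beta : R) : R := K * Rpower 6 s * / (1 - Rpower 2 (s - beta)).

Lemma Rpower_lt_1 (g : R) : g < 0 -> Rpower 2 g < 1.
Proof. intros Hg. rewrite <- (Rpower_O 2) by lra. apply Rpower_lt; lra. Qed.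

Lemma far_const_pos (K s beta : R) : 0 < K -> s < beta -> 0 < far_const K s beta.
Proof.
  intros HK Hs. pose proof (Rpower_lt_1 (s - beta) ltac:(lra)).
  unfold far_const. apply Rmult_lt_0_compat; [|apply Rinv_0_lt_compat; lra].
  apply Rmult_lt_0_compat; [lra|apply Rpower_pos].
Qed.

(** At scale 2^k rho the kernel times the mass is of order (2^k rho)^(s - beta). As s < beta this
    decays geometrically in k, and the smallest scale decides. *)
Lemma mean_far (n : nat) (s K beta rho : R) (L : pt -> Prop) (J : (pt -> R) -> R) (x : pt) :
  (forall y, L y -> unit_sphere n y) -> is_mean L J ->
  (forall x r, 0 < r -> J (ind (fun y => dist n x y <= r)) <= K * Rpower (3 * r) s) ->
  0 < K -> 0 < s < beta -> 0 < rho -> vnorm n x < 1 ->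
  J (far n beta rho x) <= far_const K s beta * Rpower rho (s - beta).
Proof.
  intros HL HJ Hup HK Hs Hr Hx.
  (* From 1/N < rho/2 and 2^N >= 1 + N it follows that 2^N rho > 2, which exceeds every distance
     from [x] to the sphere. *)
  destruct (archimed_cor1 (rho / 2)) as [N [HN HN0]]; [lra|].
  assert (Hbig : 2 < 2 ^ N * rho).
  { pose proof (poly N 1 ltac:(lra)) as HP. replace (1 + 1) with 2 in HP by ring.
    apply lt_0_INR in HN0.
    assert (1 < INR N * (rho / 2)).
    { apply (Rmult_lt_reg_l (/ INR N)); [now apply Rinv_0_lt_compat|].
      rewrite <- Rmult_assoc, Rinv_l by lra. lra. }
    nra. }
  assert (Hbd : forall k : nat, (k < N)%nat ->
      bdd_on L (fun y => Rpower (2 ^ k * rho) (- beta) * ind (fun y => dist n x y <= 2 ^ S k * rho) y)).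
  { intros k _. apply bdd_on_scal, bdd_on_ind. }
  apply Rle_trans with (J (fun y => rsum N (fun k => Rpower (2 ^ k * rho) (- beta) *
                                  ind (fun y => dist n x y <= 2 ^ S k * rho) y))).
  { apply (mean_le L); [exact HJ|apply bdd_on_far; lra| |].
    - apply (bdd_on_rsum L N (fun k y => Rpower (2 ^ k * rho) (- beta) *
                                  ind (fun y => dist n x y <= 2 ^ S k * rho) y)); auto.
    - intros y Hy. apply far_le_dyadic; try lra.
      pose proof (dist_sphere_bounds n x y (HL y Hy)). lra. }
  rewrite (mean_rsum L J N (fun k y => Rpower (2 ^ k * rho) (- beta) *
                                  ind (fun y => dist n x y <= 2 ^ S k * rho) y)) by auto.
  set (q := Rpower 2 (s - beta)).
  assert (Hq : 0 < q < 1) by (split; [apply Rpower_pos|apply Rpower_lt_1; lra]).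
  apply Rle_trans with (rsum N (fun k => (K * Rpower 6 s * Rpower rho (s - beta)) * q ^ k)).
  - apply rsum_le. intros k _.
    rewrite (mean_scal L) by (auto using bdd_on_ind).
    assert (Hk : 0 < 2 ^ k * rho) by (apply Rmult_lt_0_compat; [apply pow_lt; lra|lra]).
    assert (HSk : 2 ^ S k * rho = 2 * (2 ^ k * rho)) by (simpl; ring).
    eapply Rle_trans; [apply Rmult_le_compat_l; [left; apply Rpower_pos|apply Hup; rewrite HSk; lra]|].
    rewrite HSk. replace (3 * (2 * (2 ^ k * rho))) with (6 * (2 ^ k * rho)) by ring.
    rewrite <- (Rpower_mult_distr 6) by lra.
    replace (Rpower (2 ^ k * rho) (- beta) * (K * (Rpower 6 s * Rpower (2 ^ k * rho) s)))
      with (K * Rpower 6 s * (Rpower (2 ^ k * rho) s * Rpower (2 ^ k * rho) (- beta))) by ring.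
    rewrite <- Rpower_plus. fold (s - beta). rewrite Rpower_pow2_mult by lra. fold q. lra.
  - rewrite rsum_scal. unfold far_const. fold q.
    pose proof (geometric_rsum_le q N (proj1 Hq) (proj2 Hq)).
    replace (K * Rpower 6 s * / (1 - q) * Rpower rho (s - beta))
      with (K * Rpower 6 s * Rpower rho (s - beta) * / (1 - q)) by ring.
    apply Rmult_le_compat_l; [|exact H].
    left. repeat apply Rmult_lt_0_compat; try apply Rpower_pos; lra.
Qed.

(** * The Poisson kernel against the hyperbolic distance, and decay *)

Lemma hyp_dist_origin (n : nat) (x : pt) : vnorm n x < 1 ->
  hyp_dist n x origin = ln ((1 + vnorm n x) / (1 - vnorm n x)).
Proof.
  intros Hx. unfold hyp_dist, arcosh. rewrite dist_origin, vnorm_origin.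
  pose proof (vnorm_nonneg n x) as H0. set (r := vnorm n x) in *. f_equal.
  replace (1 + 2 * r ^ 2 / ((1 - r ^ 2) * (1 - 0 ^ 2))) with ((1 + r ^ 2) / (1 - r ^ 2))
    by (field; nra).
  (* A perfect square, so the root in [arcosh] becomes rational in r. *)
  replace (((1 + r ^ 2) / (1 - r ^ 2)) ^ 2 - 1) with ((2 * r / (1 - r ^ 2)) ^ 2) by (field; nra).
  rewrite sqrt_pow2.
  - field. split; nra.
  - apply Rmult_le_pos; [lra|]. left. apply Rinv_0_lt_compat. nra.
Qed.

Lemma ln_le_mono (a b : R) : 0 < a -> a <= b -> ln a <= ln b.
Proof. intros Ha [H| ->]; [left; now apply ln_increasing|lra]. Qed.

Lemma hyp_dist_origin_nonneg (n : nat) (x : pt) : vnorm n x < 1 -> 0 <= hyp_dist n x origin.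
Proof.
  intros Hx. rewrite hyp_dist_origin by exact Hx. pose proof (vnorm_nonneg n x).
  rewrite <- ln_1. apply ln_le_mono; [lra|].
  apply (Rmult_le_reg_r (1 - vnorm n x)); [lra|]. unfold Rdiv. rewrite Rmult_assoc, Rinv_l by lra. lra.
Qed.

Lemma poisson_pos (n : nat) (x y : pt) : vnorm n x < 1 -> unit_sphere n y -> 0 < poisson n x y.
Proof.
  intros Hx Hy. apply Rdiv_lt_0_compat; [now apply bdy_defect_pos|now apply dist2_pos].
Qed.

(** As 1 - r <= |x - xi| <= 1 + r for r = |x|, the kernel P lies between (1 - r)/(1 + r) and (1 +
    r)/(1 - r). Here ln P is, up to sign, the Busemann function at xi normalized at [o]. *)
Lemma Rabs_ln_poisson_le (n : nat) (x y : pt) : vnorm n x < 1 -> unit_sphere n y ->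
  Rabs (ln (poisson n x y)) <= hyp_dist n x origin.
Proof.
  intros Hx Hy. rewrite hyp_dist_origin by exact Hx.
  pose proof (dist_sphere_bounds n x y Hy) as HB. pose proof (vnorm_nonneg n x) as H0.
  pose proof (poisson_pos n x y Hx Hy) as HP.
  assert (E : poisson n x y = (1 - vnorm n x) * (1 + vnorm n x) / dist n x y ^ 2).
  { unfold poisson. rewrite bdy_defect_vnorm, dist2_dist. f_equal. ring. }
  set (r := vnorm n x) in *. set (t := dist n x y) in *.
  assert (Ht : 0 < t ^ 2) by (apply pow_lt; lra).
  apply Rabs_le. split.
  - rewrite <- ln_Rinv by (apply Rdiv_lt_0_compat; lra). apply ln_le_mono.
    + apply Rinv_0_lt_compat, Rdiv_lt_0_compat; lra.
    + rewrite E. apply (Rmult_le_reg_r (t ^ 2 * (1 + r))); [nra|].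
      replace (/ ((1 + r) / (1 - r)) * (t ^ 2 * (1 + r))) with ((1 - r) * t ^ 2) by (field; lra).
      replace ((1 - r) * (1 + r) / t ^ 2 * (t ^ 2 * (1 + r))) with ((1 - r) * (1 + r) ^ 2)
        by (field; lra).
      apply Rmult_le_compat_l; [lra|]. apply pow_incr. lra.
  - apply ln_le_mono; [exact HP|]. rewrite E. apply (Rmult_le_reg_r (t ^ 2 * (1 - r))); [nra|].
    replace ((1 + r) / (1 - r) * (t ^ 2 * (1 - r))) with ((1 + r) * t ^ 2) by (field; lra).
    replace ((1 - r) * (1 + r) / t ^ 2 * (t ^ 2 * (1 - r))) with ((1 + r) * (1 - r) ^ 2)
      by (field; lra).
    apply Rmult_le_compat_l; [lra|]. apply pow_incr. lra.
Qed.

Lemma poisson_power_le_far (n : nat) (alpha rho : R) (x y : pt) : 0 <= alpha ->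
  vnorm n x < 1 -> unit_sphere n y -> rho <= dist n x y ->
  exp (alpha * ln (poisson n x y)) <=
  Rpower (2 * (1 - vnorm n x)) alpha * far n (2 * alpha) rho x y.
Proof.
  intros Ha Hx Hy Hr. pose proof (dist_sphere_bounds n x y Hy) as HB.
  pose proof (vnorm_nonneg n x) as H0.
  unfold far. destruct (Rle_dec rho (dist n x y)) as [_|h]; [|contradiction].
  pose proof (bdy_defect_pos n x Hx) as HA.
  assert (E : exp (alpha * ln (poisson n x y)) =
    Rpower (bdy_defect n x) alpha * Rpower (dist n x y) (- (2 * alpha))).
  { unfold Rpower. rewrite <- exp_plus. f_equal. unfold poisson. rewrite dist2_dist.
    unfold Rdiv. rewrite ln_mult, ln_Rinv by (try apply Rinv_0_lt_compat; try apply pow_lt; lra).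
    replace (dist n x y ^ 2) with (dist n x y * dist n x y) by ring.
    rewrite ln_mult by lra. ring. }
  rewrite E. apply Rmult_le_compat_r; [left; apply Rpower_pos|].
  apply Rle_Rpower_l; [exact Ha|]. split; [exact HA|].
  rewrite bdy_defect_vnorm. nra.
Qed.

Lemma mean_abs_dom (L : pt -> Prop) (J : (pt -> R) -> R) (f g : pt -> R) : is_mean L J ->
  bdd_on L f -> bdd_on L g -> (forall y, L y -> Rabs (f y) <= g y) -> Rabs (J f) <= J g.
Proof.
  intros HJ Hf Hg H. apply Rabs_le. split.
  - replace (- J g) with (-1 * J g) by ring. rewrite <- (mean_scal L J g (-1) HJ Hg).
    apply (mean_le L); auto using bdd_on_scal. intros y Hy. specialize (H y Hy).
    pose proof (Rle_abs (- f y)). rewrite Rabs_Ropp in *. lra.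
  - apply (mean_le L); auto. intros y Hy. specialize (H y Hy). pose proof (Rle_abs (f y)). lra.
Qed.

(** 2^s is 2^alpha, from A <= 2 (1 - |x|), times 2^(s - alpha), from 1 - |x| <= 2 exp(-d). *)
Definition decay_const (K s alpha : R) : R := Rpower 2 s * far_const K s (2 * alpha).

Lemma mean_log_poisson_decay (n : nat) (s K alpha : R) (L : pt -> Prop) (J : (pt -> R) -> R) (x : pt) :
  (forall y, L y -> unit_sphere n y) -> is_mean L J ->
  (forall x r, 0 < r -> J (ind (fun y => dist n x y <= r)) <= K * Rpower (3 * r) s) ->
  0 < K -> 0 < alpha -> alpha < s < 2 * alpha -> unit_ball n x ->
  Rabs (J (ev n alpha log_poisson x)) <=
  decay_const K s alpha * hyp_dist n x origin * exp (- (s - alpha) * hyp_dist n x origin).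
Proof.
  intros HL HJ Hup HK Ha Hs Hxb. destruct (Hxb) as [_ Hx].
  pose proof (vnorm_nonneg n x) as Hr0. pose proof (hyp_dist_origin_nonneg n x Hx) as Hd0.
  set (r := vnorm n x) in *. set (d := hyp_dist n x origin) in *.
  set (c := d * Rpower (2 * (1 - r)) alpha).
  assert (Hc : 0 <= c) by (apply Rmult_le_pos; [exact Hd0|left; apply Rpower_pos]).
  (* At the cutoff 1 - |x| nothing is truncated, for the sphere is at least that far from [x]. *)
  apply Rle_trans with (c * J (far n (2 * alpha) (1 - r) x)).
  { rewrite <- (mean_scal L) by (auto; apply bdd_on_far; lra).
    apply (mean_abs_dom L); auto.
    - apply bdd_on_ev; auto; lra.
    - apply bdd_on_scal, bdd_on_far; lra.
    - intros y Hy. simpl. rewrite Rabs_mult, (Rabs_pos_eq (exp _)) by (left; apply exp_pos).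
      unfold c. rewrite (Rmult_comm (exp _)), Rmult_assoc.
      apply Rmult_le_compat; [apply Rabs_pos|left; apply exp_pos| |].
      + now apply Rabs_ln_poisson_le; auto.
      + apply poisson_power_le_far; auto; [lra|]. apply (dist_sphere_bounds n x y); auto. }
  pose proof (mean_far n s K (2 * alpha) (1 - r) L J x HL HJ Hup HK ltac:(lra) ltac:(lra) Hx) as HF.
  eapply Rle_trans; [apply Rmult_le_compat_l; [exact Hc|exact HF]|].
  (* This is d = ln((1 + r)/(1 - r)) solved for 1 - r; it turns the power (1 - r)^(s - alpha) into
     exponential decay in d. *)
  assert (Hdr : 1 - r = (1 + r) * exp (- d)).
  { unfold d. rewrite hyp_dist_origin by exact Hx. fold r.
    rewrite <- ln_Rinv by (apply Rdiv_lt_0_compat; lra).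
    rewrite exp_ln by (apply Rinv_0_lt_compat, Rdiv_lt_0_compat; lra). field. lra. }
  assert (Hpow : Rpower (2 * (1 - r)) alpha * Rpower (1 - r) (s - 2 * alpha)
            <= Rpower 2 s * exp (- (s - alpha) * d)).
  { rewrite <- Rpower_mult_distr by lra.
    rewrite Rmult_assoc, <- Rpower_plus. replace (alpha + (s - 2 * alpha)) with (s - alpha) by ring.
    replace (Rpower 2 s) with (Rpower 2 alpha * Rpower 2 (s - alpha))
      by (rewrite <- Rpower_plus; f_equal; ring).
    rewrite Rmult_assoc. apply Rmult_le_compat_l; [left; apply Rpower_pos|].
    replace (exp (- (s - alpha) * d)) with (Rpower (exp (- d)) (s - alpha))
      by (unfold Rpower; rewrite ln_exp; f_equal; ring).
    pose proof (exp_pos (- d)).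
    rewrite Rpower_mult_distr by lra. apply Rle_Rpower_l; [lra|]. nra. }
  unfold c, decay_const.
  pose proof (far_const_pos K s (2 * alpha) HK ltac:(lra)) as HC.
  replace (d * Rpower (2 * (1 - r)) alpha * (far_const K s (2 * alpha) * Rpower (1 - r) (s - 2 * alpha)))
    with (d * far_const K s (2 * alpha) *
      (Rpower (2 * (1 - r)) alpha * Rpower (1 - r) (s - 2 * alpha))) by ring.
  replace (Rpower 2 s * far_const K s (2 * alpha) * d * exp (- (s - alpha) * d))
    with (d * far_const K s (2 * alpha) * (Rpower 2 s * exp (- (s - alpha) * d))) by ring.
  apply Rmult_le_compat_l; [|exact Hpow]. apply Rmult_le_pos; lra.
Qed.

(** * The sign of u near the sphere *)

Definition scale (c : R) (x : pt) : pt := fun i => c * x i.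

Lemma vnorm_scale (n : nat) (c : R) (x : pt) : 0 <= c -> vnorm n (scale c x) = c * vnorm n x.
Proof.
  intros Hc. unfold vnorm, scale.
  rewrite (rsum_ext n _ (fun i => c ^ 2 * x i ^ 2)) by (intros; ring).
  rewrite rsum_scal, sqrt_mult_alt by apply pow2_ge_0. now rewrite sqrt_pow2.
Qed.

Lemma dist_scale (n : nat) (c : R) (x : pt) : c <= 1 -> dist n (scale c x) x = (1 - c) * vnorm n x.
Proof.
  intros Hc. rewrite <- vnorm_scale by lra. apply vnorm_ext.
  intros; unfold vsub, scale; ring.
Qed.

Lemma unit_ball_scale (n : nat) (c : R) (x : pt) : 0 <= c < 1 -> unit_sphere n x ->
  unit_ball n (scale c x).
Proof.
  intros Hc [Hx Hx1]. split.
  - intros i Hi. unfold scale. rewrite (Hx i Hi). ring.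
  - rewrite vnorm_scale, Hx1 by lra. lra.
Qed.

(* Near p the factor P is at least 1/(4 delta); it drops below 1 only at
   distance sqrt delta from x, where the dyadic bound takes over. *)
Lemma log_poisson_radial_ge (n : nat) (alpha delta : R) (p y : pt) :
  0 < alpha -> 0 < delta < / 4 -> unit_sphere n p -> unit_sphere n y ->
  let x := scale (1 - delta) p in
  Rpower (4 * delta) (- alpha) * - ln (4 * delta) * ind (fun y => dist n p y < delta) y
    - (ln 2 - ln delta) * Rpower (2 * delta) alpha * far n (2 * alpha) (sqrt delta) x y
  <= ev n alpha log_poisson x y.
Proof.
  intros Ha Hd Hp Hy x.
  assert (Hxb : unit_ball n x) by (apply unit_ball_scale; [lra|exact Hp]).
  destruct (Hxb) as [_ Hx].
  assert (Hr : vnorm n x = 1 - delta).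
  { unfold x. rewrite vnorm_scale by lra. destruct Hp as [_ ->]. ring. }
  assert (Hxp : dist n x p = delta).
  { unfold x. rewrite dist_scale by lra. destruct Hp as [_ ->]. ring. }
  pose proof (poisson_pos n x y Hx Hy) as HP.
  pose proof (dist2_pos n x y Hx Hy) as HB.
  pose proof (bdy_defect_pos n x Hx) as HA.
  assert (HAd : delta <= bdy_defect n x) by (rewrite bdy_defect_vnorm, Hr; nra).
  assert (Hs : 0 < sqrt delta) by (apply sqrt_lt_R0; lra).
  pose proof (far_bounds n (2 * alpha) (sqrt delta) x y ltac:(lra) Hs) as HF.
  pose proof (Rpower_pos (2 * delta) alpha) as H2.
  assert (Hl2 : 0 < ln 2 - ln delta).
  { pose proof (ln_increasing delta 2 ltac:(lra) ltac:(lra)). lra. }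
  assert (Hfar : 0 <= (ln 2 - ln delta) * Rpower (2 * delta) alpha * far n (2 * alpha) (sqrt delta) x y).
  { repeat apply Rmult_le_pos; lra. }
  simpl ev. destruct (classic (dist n p y < delta)) as [Hpy|Hpy].
  - rewrite ind_true by exact Hpy.
    pose proof (dist_triangle n x p y). pose proof (dist_nonneg n x y).
    (* Here |x - y| < 2 delta and A >= delta, so P >= delta / (2 delta)^2. *)
    assert (HPd : / (4 * delta) <= poisson n x y).
    { unfold poisson. apply (Rmult_le_reg_r (4 * delta * dist2 n x y)); [nra|].
      replace (/ (4 * delta) * (4 * delta * dist2 n x y)) with (dist2 n x y) by (field; lra).
      replace (bdy_defect n x / dist2 n x y * (4 * delta * dist2 n x y))
        with (4 * delta * bdy_defect n x) by (field; lra).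
      rewrite dist2_dist. nra. }
    assert (Hln : - ln (4 * delta) <= ln (poisson n x y)).
    { rewrite <- ln_Rinv by lra. apply ln_le_mono; [apply Rinv_0_lt_compat; lra|exact HPd]. }
    assert (Hln0 : 0 < - ln (4 * delta)).
    { pose proof (ln_increasing (4 * delta) 1 ltac:(lra) ltac:(lra)). rewrite ln_1 in *. lra. }
    assert (Rpower (4 * delta) (- alpha) * - ln (4 * delta)
      <= exp (alpha * ln (poisson n x y)) * ln (poisson n x y)).
    { apply Rmult_le_compat; [left; apply Rpower_pos|lra| |exact Hln].
      unfold Rpower. apply exp_le_mono. nra. }
    lra.
  - rewrite ind_false by exact Hpy. rewrite Rmult_0_r.
    pose proof (exp_pos (alpha * ln (poisson n x y))) as HE.
    (* Where P >= 1 the kernel is nonnegative while the claimed lower bound is at most 0. *)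
    destruct (Rle_lt_dec 0 (ln (poisson n x y))) as [Hl|Hl]; [nra|].
    assert (HP1 : poisson n x y < 1).
    { apply Rnot_le_lt. intros H. apply (ln_le_mono 1) in H; [|lra]. rewrite ln_1 in H. lra. }
    (* P < 1 means |x - y|^2 > A, and A >= delta. *)
    assert (Hsd : sqrt delta <= dist n x y).
    { rewrite <- (sqrt_pow2 (dist n x y)) by apply dist_nonneg. apply sqrt_le_1_alt.
      rewrite <- dist2_dist. apply Rle_trans with (bdy_defect n x); [exact HAd|].
      unfold poisson in HP1. apply (Rmult_lt_compat_r (dist2 n x y)) in HP1; [|exact HB].
      unfold Rdiv in HP1. rewrite Rmult_assoc, Rinv_l in HP1 by lra. lra. }
    pose proof (poisson_power_le_far n alpha (sqrt delta) x y ltac:(lra) Hx Hy Hsd) as HQ.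
    rewrite Hr in HQ. replace (1 - (1 - delta)) with delta in HQ by ring.
    pose proof (Rabs_ln_poisson_le n x y Hx Hy) as HL.
    rewrite Rabs_left in HL by exact Hl.
    assert (Hdd : hyp_dist n x origin <= ln 2 - ln delta).
    { rewrite hyp_dist_origin by exact Hx. rewrite Hr. unfold Rdiv.
      rewrite ln_mult, ln_Rinv by (try apply Rinv_0_lt_compat; lra).
      replace (1 - (1 - delta)) with delta by ring.
      pose proof (ln_le_mono (1 + (1 - delta)) 2 ltac:(lra) ltac:(lra)). lra. }
    assert (exp (alpha * ln (poisson n x y)) * - ln (poisson n x y) <=
      (Rpower (2 * delta) alpha * far n (2 * alpha) (sqrt delta) x y) * (ln 2 - ln delta)).
    { apply Rmult_le_compat; lra. }
    lra.
Qed.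

Lemma mean_log_poisson_radial_pos (n : nat) (s K alpha c r0 : R) (L : pt -> Prop)
  (J : (pt -> R) -> R) (p : pt) :
  (forall y, L y -> unit_sphere n y) -> is_mean L J ->
  (forall x r, 0 < r -> J (ind (fun y => dist n x y <= r)) <= K * Rpower (3 * r) s) ->
  0 < K -> 0 < alpha -> alpha < s < 2 * alpha -> L p -> 0 < c -> 0 < r0 ->
  (forall r, 0 < r < r0 -> c * Rpower r s <= J (ind (fun y => dist n p y < r))) ->
  exists T, forall t, T < t -> 0 < J (ev n alpha log_poisson (scale (1 - exp (- t)) p)).
Proof.
  intros HL HJ Hup HK Ha Hs Hp Hc Hr0 Hlow.
  pose (C := far_const K s (2 * alpha)).
  assert (HC : 0 < C) by (apply far_const_pos; lra).
  (* The gap between the exponents of the two competing parts: s/2 - (s - alpha). *)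
  pose (kappa := alpha - s / 2). assert (Hk : 0 < kappa) by (unfold kappa; lra).
  pose (c1 := Rpower 4 (- alpha) * c). pose (c2 := Rpower 2 alpha * C).
  assert (Hc1 : 0 < c1) by (apply Rmult_lt_0_compat; [apply Rpower_pos|exact Hc]).
  assert (Hc2 : 0 < c2) by (apply Rmult_lt_0_compat; [apply Rpower_pos|exact HC]).
  assert (Hln2 : 0 < ln 2).
  { rewrite <- ln_1. apply ln_increasing; lra. }
  (* With delta = exp(-t): t > 5 ln 2 gives delta < 1/4 and ln 2 + t <= 2 (t - 2 ln 2), the second
     entry gives delta < r0, and the third makes 2 c2 exp(-kappa t) < c1. *)
  pose (T := Rmax (5 * ln 2) (Rmax (- ln r0) (ln (2 * c2 / c1) / kappa))).
  exists T. intros t Ht.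
  assert (Ht1 : 5 * ln 2 < t) by (eapply Rle_lt_trans; [apply Rmax_l|exact Ht]).
  assert (Ht23 : Rmax (- ln r0) (ln (2 * c2 / c1) / kappa) < t)
    by (eapply Rle_lt_trans; [apply Rmax_r|exact Ht]).
  assert (Ht2 : - ln r0 < t) by (eapply Rle_lt_trans; [apply Rmax_l|exact Ht23]).
  assert (Ht3 : ln (2 * c2 / c1) / kappa < t) by (eapply Rle_lt_trans; [apply Rmax_r|exact Ht23]).
  set (delta := exp (- t)).
  assert (Hln4 : ln 4 = 2 * ln 2).
  { replace 4 with (2 * 2) by ring. rewrite ln_mult by lra. ring. }
  assert (Hd4 : 0 < delta < / 4).
  { split; [apply exp_pos|]. unfold delta. rewrite <- (exp_ln (/ 4)) by lra.
    apply exp_increasing. rewrite ln_Rinv, Hln4 by lra. lra. }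
  assert (Hdr : delta < r0).
  { unfold delta. rewrite <- (exp_ln r0) by exact Hr0. apply exp_increasing. lra. }
  assert (Hlnd : ln delta = - t) by (unfold delta; apply ln_exp).
  set (x := scale (1 - delta) p).
  assert (Hxb : unit_ball n x) by (apply unit_ball_scale; [lra|now apply HL]).
  assert (Hsd : 0 < sqrt delta) by (apply sqrt_lt_R0; lra).
  set (a1 := Rpower (4 * delta) (- alpha) * - ln (4 * delta)).
  set (a2 := (ln 2 - ln delta) * Rpower (2 * delta) alpha).
  pose proof (mean_far n s K (2 * alpha) (sqrt delta) L J x HL HJ Hup HK ltac:(lra) Hsd
                (proj2 Hxb)) as HF. fold C in HF.
  pose proof (Hlow delta ltac:(lra)) as Hlo.
  assert (Hl4d : - ln (4 * delta) = t - 2 * ln 2) by (rewrite ln_mult by lra; lra).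
  assert (H1 : a1 * J (ind (fun y => dist n p y < delta)) + - a2 * J (far n (2 * alpha) (sqrt delta) x)
    <= J (ev n alpha log_poisson x)).
  { rewrite <- (mean_scal L J _ a1) by (auto using bdd_on_ind).
    rewrite <- (proj1 HJ) by (try apply bdd_on_scal; auto using bdd_on_ind; apply bdd_on_far; lra).
    apply (mean_le L); auto.
    - apply bdd_on_lin; [apply bdd_on_scal, bdd_on_ind|apply bdd_on_far; lra].
    - apply bdd_on_ev; auto; lra.
    - intros y Hy. eapply Rle_trans; [|apply log_poisson_radial_ge; auto]. fold x.
      unfold a1, a2. lra. }
  assert (E1 : Rpower (4 * delta) (- alpha) * (c * Rpower delta s)
    = c1 * (exp ((alpha - s) * t))).
  { rewrite <- Rpower_mult_distr by lra. unfold c1.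
    replace (exp ((alpha - s) * t)) with (Rpower delta (- alpha) * Rpower delta s); [ring|].
    rewrite <- Rpower_plus. unfold Rpower. rewrite Hlnd. f_equal. ring. }
  (* The power of delta is alpha + (s - 2 alpha)/2 = s/2 = (s - alpha) + kappa. *)
  assert (E2 : Rpower (2 * delta) alpha * (C * Rpower (sqrt delta) (s - 2 * alpha))
    = c2 * (exp ((alpha - s) * t) * exp (- kappa * t))).
  { rewrite <- Rpower_mult_distr by lra. unfold c2.
    rewrite <- (Rpower_sqrt delta) by lra. rewrite Rpower_mult.
    replace (exp ((alpha - s) * t) * exp (- kappa * t))
      with (Rpower delta alpha * Rpower delta (/ 2 * (s - 2 * alpha))); [ring|].
    rewrite <- Rpower_plus, <- exp_plus. unfold Rpower. rewrite Hlnd. f_equal.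
    unfold kappa. field. }
  assert (Ha1 : c1 * exp ((alpha - s) * t) * (t - 2 * ln 2)
     <= a1 * J (ind (fun y => dist n p y < delta))).
  { rewrite <- E1. unfold a1. rewrite Hl4d.
    replace (Rpower (4 * delta) (- alpha) * (c * Rpower delta s) * (t - 2 * ln 2))
      with (Rpower (4 * delta) (- alpha) * (t - 2 * ln 2) * (c * Rpower delta s)) by ring.
    apply Rmult_le_compat_l; [|exact Hlo]. apply Rmult_le_pos; [left; apply Rpower_pos|lra]. }
  assert (Ha2 : a2 * J (far n (2 * alpha) (sqrt delta) x)
     <= (ln 2 + t) * (c2 * (exp ((alpha - s) * t) * exp (- kappa * t)))).
  { rewrite <- E2. unfold a2. rewrite Hlnd. replace (ln 2 - - t) with (ln 2 + t) by ring.
    rewrite Rmult_assoc. apply Rmult_le_compat_l; [lra|].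
    apply Rmult_le_compat_l; [left; apply Rpower_pos|exact HF]. }
  assert (Hsmall : 2 * c2 * exp (- kappa * t) < c1).
  { assert (Hlt : ln (2 * c2 / c1) < kappa * t).
    { apply (Rmult_lt_reg_r (/ kappa)); [now apply Rinv_0_lt_compat|].
      replace (kappa * t * / kappa) with t by (field; lra). exact Ht3. }
    apply exp_increasing in Hlt. rewrite exp_ln in Hlt by (apply Rdiv_lt_0_compat; lra).
    replace (- kappa * t) with (- (kappa * t)) by ring. rewrite exp_Ropp.
    pose proof (exp_pos (kappa * t)) as He.
    apply (Rmult_lt_reg_r (exp (kappa * t) * / c1));
      [apply Rmult_lt_0_compat; [exact He|now apply Rinv_0_lt_compat]|].
    replace (2 * c2 * / exp (kappa * t) * (exp (kappa * t) * / c1)) with (2 * c2 / c1) by (field; lra).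
    replace (c1 * (exp (kappa * t) * / c1)) with (exp (kappa * t)) by (field; lra). exact Hlt. }
  pose proof (exp_pos ((alpha - s) * t)) as HE. set (E := exp ((alpha - s) * t)) in *.
  pose proof (exp_pos (- kappa * t)) as HQ. set (Q := exp (- kappa * t)) in *.
  assert (Hfin : 0 < E * (c1 * (t - 2 * ln 2) - (ln 2 + t) * (c2 * Q))).
  { apply Rmult_lt_0_compat; [exact HE|].
    assert ((ln 2 + t) * (c2 * Q) <= 2 * (t - 2 * ln 2) * (c2 * Q)).
    { apply Rmult_le_compat_r; [apply Rmult_le_pos; lra|lra]. }
    assert (0 < (t - 2 * ln 2) * (c1 - 2 * c2 * Q)) by (apply Rmult_lt_0_compat; lra).
    lra. }
  fold delta x. lra.
Qed.

(** Condition (iv) speaks of balls centered on [L]. A ball meeting [L] at q lies in the ball of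
    radius 2r about q; the comparison with H^s enlarges it by r/2, and 3r leaves the strict
    inequality. A ball that misses [L] has mean at most 0. *)
Lemma mean_ball_le (n : nat) (s K : R) (L : pt -> Prop) (J : (pt -> R) -> R) : is_mean L J -> 0 < s ->
  0 < K -> (forall y, L y -> inRn n y) ->
  (forall p r, L p -> 0 < r -> Hs_le n s (inter L (eball n p r)) (K * Rpower r s)) ->
  (forall (A A' : pt -> Prop) eta, 0 < eta ->
      (forall x y, L x -> L y -> A x -> dist n x y <= eta -> A' y) ->
      forall c, Hs_le n s (inter L A') c -> J (ind A) <= c) ->
  forall x r, 0 < r -> J (ind (fun y => dist n x y <= r)) <= K * Rpower (3 * r) s.
Proof.
  intros HJ Hs HK HL Hup Hmean x r Hr.
  destruct (classic (exists q, L q /\ dist n x q <= r)) as [[q [Lq Hq]]|Hn].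
  - apply (Hmean _ (eball n q (3 * r)) (r / 2)); [lra| |apply Hup; [exact Lq|lra]].
    intros z y Lz Ly Hz Hzy. split; [auto|].
    pose proof (dist_triangle n y z x). pose proof (dist_triangle n y x q).
    rewrite (dist_sym n y z), (dist_sym n z x) in *. lra.
  - apply Rle_trans with (0 * J (fun _ => 1)).
    + rewrite <- (mean_scal L) by (auto using bdd_on_const). apply (mean_le L); auto using bdd_on_ind.
      * apply bdd_on_scal, bdd_on_const.
      * intros y Hy. rewrite ind_false; [lra|]. intros H. apply Hn. now exists y.
    + rewrite Rmult_0_l. apply Rmult_le_pos; [lra|left; apply Rpower_pos].
Qed.

(** The first threshold gives B >= (eta/2)^2. The second gives A <= 2 (1 - |x|) <= 2 |x - xi| <
    eta^2/4. Together P <= 1 at every point of [L]. *)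
Lemma mean_log_poisson_nonpos (n : nat) (alpha eta : R) (L : pt -> Prop) (J : (pt -> R) -> R) (x xi : pt) :
  (forall y, L y -> unit_sphere n y) -> is_mean L J -> 0 <= alpha -> 0 < eta ->
  (forall y, L y -> eta <= dist n y xi) -> unit_ball n x -> unit_sphere n xi ->
  dist n x xi < Rmin (eta / 2) (eta ^ 2 / 8) ->
  J (ev n alpha log_poisson x) <= 0.
Proof.
  intros HL HJ Ha Heta Hfar Hxb Hxi Hd. destruct (Hxb) as [_ Hx].
  pose proof (Rmin_l (eta / 2) (eta ^ 2 / 8)). pose proof (Rmin_r (eta / 2) (eta ^ 2 / 8)).
  rewrite <- (Rmult_0_l (J (fun _ => 1))), <- (mean_scal L) by (auto using bdd_on_const).
  apply (mean_le L); auto.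
  - now apply bdd_on_ev.
  - apply bdd_on_scal, bdd_on_const.
  - intros y Hy. rewrite Rmult_0_l. simpl.
    assert (HP1 : poisson n x y <= 1).
    { pose proof (dist2_pos n x y Hx (HL y Hy)) as HB. unfold poisson.
      apply (Rmult_le_reg_r (dist2 n x y)); [exact HB|].
      unfold Rdiv. rewrite Rmult_assoc, Rinv_l, Rmult_1_r, Rmult_1_l by lra.
      rewrite bdy_defect_vnorm, dist2_dist.
      pose proof (dist_sphere_bounds n x xi Hxi). pose proof (vnorm_nonneg n x).
      pose proof (dist_triangle n y x xi) as HT. rewrite (dist_sym n y x) in HT.
      specialize (Hfar y Hy). nra. }
    pose proof (ln_le_mono _ _ (poisson_pos n x y Hx (HL y Hy)) HP1) as Hl. rewrite ln_1 in Hl.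
    pose proof (exp_pos (alpha * ln (poisson n x y))). nra.
Qed.

Theorem mainTheorem10 :
  forall (n : nat) (s K : R),
    (2 <= n)%nat -> (INR n - 1) / 2 < s -> s < INR n - 1 -> 0 < K ->
    exists M0 : R, 0 < M0 /\
      forall L : pt -> Prop, truly_s_dim n s K L ->
        exists (u : pt -> R) (O : pt -> Prop),
          (exists D, is_partials n (unit_ball n) u D /\
             forall x, unit_ball n x ->
               - hyp_laplacian n D x = (INR n - 1) ^ 2 / 4 * u x) /\
          (exists C, forall x, unit_ball n x -> Rabs (u x) <= C) /\
          is_open_hyp n O /\
          (forall x, O x -> 0 < u x) /\
          (forall y, hyp_boundary n O y -> u y = 0) /\
          (forall xi, ideal_boundary n O xi <-> sphere_closure n L xi) /\
          (forall p, O p ->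
             Rabs (u p) <= M0 * (hyp_dist n p origin + 1)
                           * exp (- (s - (INR n - 1) / 2) * hyp_dist n p origin)).
Proof.
  intros n s K Hn Hs1 Hs2 HK.
  pose (alpha := (INR n - 1) / 2). fold alpha in Hs1. fold alpha.
  assert (Ha : 0 < alpha) by (apply le_INR in Hn; simpl in Hn; unfold alpha; lra).
  assert (Hs : alpha < s < 2 * alpha) by (unfold alpha in *; lra).
  (* Chosen before [L] is introduced, as the uniformity of M_0 requires. *)
  pose (M0 := decay_const K s alpha).
  assert (HM0 : 0 < M0).
  { apply Rmult_lt_0_compat; [apply Rpower_pos|apply far_const_pos; lra]. }
  exists M0. split; [exact HM0|].
  intros L [HL [_ [Hfin [Hlow [_ Hup]]]]].
  destruct (hausdorff_mean n s L ltac:(lra) Hfin) as [J [HJ HJc]].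
  assert (HJup : forall x r, 0 < r -> J (ind (fun y => dist n x y <= r)) <= K * Rpower (3 * r) s).
  { apply (mean_ball_le n s K L J HJ); auto; [lra|intros y Hy; now apply HL|].
    intros A A' eta Heta HAA. now apply (HJc A A' eta). }
  pose (u := fun x => J (ev n alpha log_poisson x)).
  assert (Hdecay : forall x, unit_ball n x -> Rabs (u x) <=
    M0 * hyp_dist n x origin * exp (- (s - alpha) * hyp_dist n x origin)).
  { intros x Hx. now apply (mean_log_poisson_decay n s K alpha L J x). }
  pose proof (continuous_on_mean_ev n alpha L J ltac:(lra) HL HJ log_poisson) as Hcont.
  fold u in Hcont.
  exists u, (fun x => unit_ball n x /\ 0 < u x).
  split; [|split; [|split; [|split; [|split; [|split]]]]].
  - eexists. split; [apply (is_partials_mean_ev n alpha L J); auto; lra|].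
    intros x Hx. apply (hyp_laplacian_mean n L); auto. lia.
  (* The inequality 1 + z <= exp z at z = (s - alpha) d gives d exp(-(s - alpha) d) <= 1/(s -
     alpha). *)
  - exists (M0 * / (s - alpha)). intros x Hx. eapply Rle_trans; [now apply Hdecay|].
    destruct (Hx) as [_ Hx1]. pose proof (hyp_dist_origin_nonneg n x Hx1) as Hd.
    set (d := hyp_dist n x origin) in *. rewrite Rmult_assoc.
    apply Rmult_le_compat_l; [lra|].
    replace (- (s - alpha) * d) with (- ((s - alpha) * d)) by ring. rewrite exp_Ropp.
    pose proof (exp_ineq1_le ((s - alpha) * d)) as Hexp.
    pose proof (exp_pos ((s - alpha) * d)).
    apply (Rmult_le_reg_r ((s - alpha) * exp ((s - alpha) * d))); [apply Rmult_lt_0_compat; lra|].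
    replace (d * / exp ((s - alpha) * d) * ((s - alpha) * exp ((s - alpha) * d)))
      with ((s - alpha) * d) by (field; lra).
    replace (/ (s - alpha) * ((s - alpha) * exp ((s - alpha) * d)))
      with (exp ((s - alpha) * d)) by (field; lra). lra.
  - split; [tauto|]. intros x [Hx Hux].
    destruct (Hcont x Hx (u x) Hux) as [d [Hd Hdc]].
    exists (Rmin d (1 - vnorm n x)). destruct (Hx) as [_ Hx1].
    split; [apply Rmin_pos; lra|]. intros y Hy Hyx.
    pose proof (Rmin_l d (1 - vnorm n x)). pose proof (Rmin_r d (1 - vnorm n x)).
    assert (Hyb : unit_ball n y).
    { split; [exact Hy|]. pose proof (vnorm_le_dist n y x). lra. }
    split; [exact Hyb|]. specialize (Hdc y Hyb ltac:(lra)). apply Rabs_def2 in Hdc. lra.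
  - tauto.
  - intros y [Hy [Hny Hb]]. apply Rle_antisym.
    + apply Rnot_lt_le. tauto.
    + apply Rnot_lt_le. intros Hneg.
      destruct (Hcont y Hy (- u y) ltac:(lra)) as [d [Hd Hdc]].
      destruct (Hb d Hd) as [x [[Hx Hux] Hxy]].
      specialize (Hdc x Hx Hxy). apply Rabs_def2 in Hdc. lra.
  - intros xi. split.
    + intros [Hxi Hnear]. split; [exact Hxi|]. intros eta Heta. apply NNPP. intros Hno.
      destruct (Hnear (Rmin (eta / 2) (eta ^ 2 / 8))) as [x [[Hx Hux] Hxd]].
      { apply Rmin_pos; [lra|]. pose proof (pow_lt eta 2 Heta). lra. }
      assert (u x <= 0); [|lra].
      apply (mean_log_poisson_nonpos n alpha eta L J x xi); auto; [lra|].
      intros y Hy. apply Rnot_lt_le. intros Hlt. apply Hno. now exists y.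
    + intros [Hxi Hnear]. split; [exact Hxi|]. intros eps Heps.
      destruct (Hnear (eps / 2) ltac:(lra)) as [p [Lp Hp]].
      destruct (Hlow p Lp) as [c [r0 [Hc [Hr0 Hge]]]].
      (* Condition (iii) is used on the ball of radius r/2, whose r/4-enlargement stays inside
         radius r; hence 2^(-s). Halving c gives the strict inequality that [Hs_ge] requires. *)
      destruct (mean_log_poisson_radial_pos n s K alpha (c / 2 * Rpower (/ 2) s) r0 L J p)
        as [T HT]; auto.
      { apply Rmult_lt_0_compat; [lra|apply Rpower_pos]. }
      { intros r Hr. apply (HJc (eball n p (r / 2)) _ (r / 4)); [lra| |].
        - intros x y Lx Ly [_ Hx] Hxy. pose proof (dist_triangle n p x y).
          rewrite (dist_sym n p x) in *. lra.
        - apply (Hge (r / 2) ltac:(lra)). unfold Rdiv at 2.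
          rewrite (Rmult_comm r), <- Rpower_mult_distr by lra.
          pose proof (Rmult_lt_0_compat _ _ (Rmult_lt_0_compat _ _ Hc (Rpower_pos (/ 2) s))
                        (Rpower_pos r s)). lra. }
      (* Beyond [T] for positivity of u, beyond 0 so that the point lies on the open radius, and
         beyond -ln(eps/2) so that it is within eps/2 of p. *)
      pose (t := Rmax (Rmax T 0) (- ln (eps / 2)) + 1).
      pose proof (Rmax_l (Rmax T 0) (- ln (eps / 2))). pose proof (Rmax_r (Rmax T 0) (- ln (eps / 2))).
      pose proof (Rmax_l T 0). pose proof (Rmax_r T 0).
      assert (Ht0 : exp (- t) < 1).
      { rewrite <- exp_0. apply exp_increasing. unfold t. lra. }
      assert (Hte : exp (- t) < eps / 2).
      { rewrite <- (exp_ln (eps / 2)) by lra. apply exp_increasing. unfold t. lra. }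
      pose proof (exp_pos (- t)).
      exists (scale (1 - exp (- t)) p). split; [split|].
      * apply unit_ball_scale; [lra|auto].
      * apply HT. unfold t. lra.
      * pose proof (dist_triangle n (scale (1 - exp (- t)) p) p xi) as Htri.
        rewrite dist_scale in Htri by lra. destruct (HL p Lp) as [_ Hp1]. rewrite Hp1 in Htri. lra.
  - intros p [Hp _]. eapply Rle_trans; [now apply Hdecay|].
    apply Rmult_le_compat_r; [left; apply exp_pos|].
    apply Rmult_le_compat_l; [lra|]. lra.
Qed.
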